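(* Let $q$ be a power of a prime $p$, $K$ the algebraic closure of $\mathbb{F}_q$, and let $m\geq 2$, $r\geq 2$ be integers with $p\nmid m$. Let $\alpha_1,\dots,\alpha_r\in K$ be pairwise distinct, let $\lambda_1,\dots,\lambda_r$ be integers with $1\leq \lambda_i<m$, put $\lambda_0:=\sum_{i=1}^r\lambda_i$, and assume $\gcd(m,\lambda_0)=1$. Let $\mathcal{X}$ be the curve over $K$ defined by $y^m=\prod_{i=1}^r (x-\alpha_i)^{\lambda_i}$ and let $Q_\infty$ be its only place at infinity. With $\eta_s$ and $\epsilon_k$ as defined in the context, the Frobenius number of $H(Q_\infty)$ is $$F_{H(Q_\infty)}=\max\{\epsilon_{r-1},\dots,\epsilon_{\lambda_0-1}\}$$ and the gap set is $$G(Q_\infty)=\left\{ma-b\lambda_0 : a,b\in\mathbb{N},\ 1\leq a\leq\lambda_0-1,\ \eta_a+1\leq b\leq\left\lfloor\frac{am}{\lambda_0}\right\rfloor\right\}.$$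
   Context: $\mathcal{X}$ denotes the nonsingular projective irreducible curve over $K$ with function field $K(\mathcal{X})=K(x,y)$; $Q_\infty$ is the unique place lying over the pole of $x$. $H(Q):=\{s\in\mathbb{N}_0 : (z)_\infty=sQ \text{ for some } z\in K(\mathcal{X})\}$, where $(z)_\infty$ is the pole divisor; $G(Q):=\mathbb{N}\setminus H(Q)$ is the gap set, and $F_{H(Q)}$ is its largest element. For $r\leq k\leq\lambda_0-1$, $$\eta_k:=\max\left\{\min_{1\leq i\leq r}\left\lfloor\frac{s_im}{\lambda_i}\right\rfloor : s_1,\dots,s_r\in\mathbb{N},\ \sum_{i=1}^r s_i=k,\ 1\leq s_i\leq\lambda_i\right\};$$ moreover $\eta_s:=0$ for $0\leq s<r$ and $\eta_s:=m-1$ for $s\geq\lambda_0$. For $k\in\mathbb{N}_0$, $\epsilon_k:=mk-\lambda_0(\eta_k+1)$ (an integer, possibly negative). *)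

(* Defs.v *)
From HB Require Import structures.
From mathcomp Require Import all_boot all_order all_algebra all_field.
From mathcomp Require Import boolp classical_sets.

Set Implicit Arguments.
Unset Strict Implicit.
Unset Printing Implicit Defensive.

Import Order.TTheory GRing.Theory Num.Theory.

Local Open Scope ring_scope.

(* A function field over K is given as a finite extension L of the rational
   function field K(x) = Frac K[X]; the points of its nonsingular projective
   model are the places of L / K. *)
Notation ratfun K := {fraction {poly K}}.

Section Places.

Variables (K : fieldType) (L : fieldExtType (ratfun K)).

Definition of_poly (f : {poly K}) : L := (tofrac f)%:A.

(* A place is given by its normalized (surjective) discrete valuation.
   Valuations are integer valued; the value at 0, mathematically +oo, is fixed
   to the junk value 0, so that two places are equal exactly when their
   valuations agree on L^*. *)
Record place := Place {
  place_ord :> L -> int;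
  place_ord0 : place_ord 0 = 0;
  place_ordM : forall f g : L, f != 0 -> g != 0 ->
    place_ord (f * g) = place_ord f + place_ord g;
  place_ordD : forall f g : L, f != 0 -> g != 0 -> f + g != 0 ->
    Order.min (place_ord f) (place_ord g) <= place_ord (f + g);
  place_ord_const : forall c : K, place_ord (of_poly c%:P) = 0;
  place_ord_surj : exists t : L, t != 0 /\ place_ord t = 1
}.

Definition over_pole_of_x (Q : place) : Prop := place_ord Q (of_poly 'X) < 0.

(* Divisors are represented by their coefficient functions. *)
Definition divisor := place -> int.

Definition pole_divisor (z : L) : divisor :=
  fun P => Order.max 0 (- place_ord P z).

Definition point_divisor (s : nat) (Q : place) : divisor :=
  fun P => if `[< P = Q >] then s%:Z else 0.

Definition weierstrass_semigroup (Q : place) : set nat :=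
  [set s | exists z : L, z != 0 /\ pole_divisor z = point_divisor s Q]%classic.

Definition gap_set (Q : place) : set nat :=
  [set s | (0 < s)%N /\ ~ weierstrass_semigroup Q s]%classic.

Definition is_frobenius_number (Q : place) (F : nat) : Prop :=
  gap_set Q F /\ forall s : nat, gap_set Q s -> (s <= F)%N.

End Places.

Section Eta.

Variables (m r : nat) (lambda : 'I_r -> nat).

Definition lambda0 : nat := (\sum_(i < r) lambda i)%N.

(* Each part of a decomposition of k is at most k, hence lies in 'I_k.+1. *)
Definition decomposition (k : nat) (s : {ffun 'I_r -> 'I_k.+1}) : bool :=
  (\sum_(i < r) s i == k)%N && [forall i, (1 <= s i <= lambda i)%N].

(* The neutral value m of the minimum is harmless: on decompositions
   s i <= lambda i, so s i * m %/ lambda i <= m. *)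
Definition eta_seq (k : nat) : nat :=
  if (k < r)%N then 0%N
  else if (lambda0 <= k)%N then m.-1
  else (\max_(s : {ffun 'I_r -> 'I_k.+1} | decomposition s)
          \big[minn/m]_(i < r) (s i * m %/ lambda i))%N.

Definition eps_seq (k : nat) : int :=
  (m * k)%N%:Z - (lambda0 * (eta_seq k).+1)%N%:Z.

End Eta.

(* Main.v *)
(* The function field is L = K(x)(y), and every z in L is a sum of m components
   c_j y^j with c_j in K(x), 0 <= j < m.  At a place over the pole of x the value
   of c_j y^j is proportional to m deg c_j + j lambda0.  As gcd(m, lambda0) = 1,
   these numbers are pairwise distinct, so the value of z is that of its dominant
   component; this gives both the uniqueness of Qinf and the pole order of z there.

   If z has no pole outside Qinf, it is integral over K[x]: otherwise a subring of
   L maximal among those containing K[x] and 1/z but not z is a valuation ring, and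
   its valuation, which is discrete because L is algebraic of bounded degree over
   K(x), is a place at which z has a pole.  Averaging over the automorphisms
   y |-> w y, w^m = 1, each c_j y^j is then integral too, and its m-th power shows
   that c_j prod_i (x - alpha_i)^floor(j lambda_i / m) is a polynomial.  Hence
   H(Qinf) is the set of all m d + j lambda0 - m sum_i floor(j lambda_i / m) with
   d >= 0 and 0 <= j < m.  Its gaps are j lambda0 - m D > 0 with
   D > sum_i floor(j lambda_i / m), and the substitution a = lambda0 - D, b = m - j
   turns this description into the one in terms of eta. *)
Require Import Defs.
From HB Require Import structures.
From mathcomp Require Import all_boot all_order all_algebra all_field.
From mathcomp Require Import boolp classical_sets.
From mathcomp Require Import zify ring.

Set Implicit Arguments.
Unset Strict Implicit.
Unset Printing Implicit Defensive.

Import Order.TTheory GRing.Theory Num.Theory.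

Local Open Scope ring_scope.

(** * Valuation rings *)

Section ValuationRings.

Variable L : fieldType.
Implicit Types (A B : set L) (u v z : L).

Definition is_subring A : Prop :=
  [/\ A 1, (forall u v, A u -> A v -> A (u - v))
    & (forall u v, A u -> A v -> A (u * v))].

(** The ring $A[u]$. Subrings are bare predicates, so a polynomial over [A] is one over [L] whose
    coefficients all lie in [A]. *)
Definition adjoin A u : set L :=
  [set v | exists2 p : {poly L}, (forall i, A p`_i) & v = p.[u]]%classic.

Definition ring_unit A u : Prop := [/\ u != 0, A u & A u^-1].

Section Subring.

Variables (A : set L) (subA : is_subring A).

Lemma subring1 : A 1. Proof. by case: subA. Qed.
Lemma subringB u v : A u -> A v -> A (u - v).
Proof. by case: subA => _ + _; apply. Qed.
Lemma subringM u v : A u -> A v -> A (u * v).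
Proof. by case: subA => _ _; apply. Qed.
Lemma subring0 : A 0.
Proof. by rewrite -(subrr 1); apply: subringB; apply: subring1. Qed.
Lemma subringN u : A u -> A (- u).
Proof. by rewrite -sub0r; apply: subringB; apply: subring0. Qed.
Lemma subringD u v : A u -> A v -> A (u + v).
Proof. by move=> Au Av; rewrite -[v]opprK; apply/subringB/subringN. Qed.
Lemma subringX u n : A u -> A (u ^+ n).
Proof.
by move=> Au; elim: n => [|n IHn]; [apply: subring1 | rewrite exprS; apply: subringM].
Qed.
Lemma subring_sum I (s : seq I) (P : pred I) (F : I -> L) :
  (forall i, P i -> A (F i)) -> A (\sum_(i <- s | P i) F i).
Proof. by move=> AF; elim/big_ind: _ => //; [apply: subring0 | apply: subringD]. Qed.

Lemma sub_adjoin u : (A `<=` adjoin A u)%classic.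
Proof.
move=> v Av; exists v%:P; last by rewrite hornerC.
by move=> i; rewrite coefC; case: ifP => // _; apply: subring0.
Qed.

Lemma mem_adjoin u : adjoin A u u.
Proof.
exists 'X; last by rewrite hornerX.
by move=> i; rewrite coefX; case: eqP => _; [apply: subring1 | apply: subring0].
Qed.

Lemma adjoin_subring u : is_subring (adjoin A u).
Proof.
split; first exact/sub_adjoin/subring1.
  move=> _ _ [p Ap ->] [q Aq ->]; exists (p - q); last by rewrite !hornerE.
  by move=> i; rewrite coefB; apply: subringB.
move=> _ _ [p Ap ->] [q Aq ->]; exists (p * q); last by rewrite hornerM.
by move=> i; rewrite coefM; apply: subring_sum => j _; apply: subringM.
Qed.

Lemma ring_unit1 : ring_unit A 1.
Proof. by split; rewrite ?invr1 ?oner_neq0 //; apply: subring1. Qed.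

Lemma ring_unitM u v : ring_unit A u -> ring_unit A v -> ring_unit A (u * v).
Proof.
move=> [u0 Au Au'] [v0 Av Av']; split; rewrite ?mulf_neq0 ?invfM //.
  exact: subringM.
exact: subringM.
Qed.

Lemma ring_unitV u : ring_unit A u -> ring_unit A u^-1.
Proof. by move=> [u0 Au Au']; split; rewrite ?invrK ?invr_eq0. Qed.

Lemma ring_unitX u n : ring_unit A u -> ring_unit A (u ^+ n).
Proof.
move=> Uu; elim: n => [|n IHn]; first by rewrite expr0; apply: ring_unit1.
by rewrite exprS; apply: ring_unitM.
Qed.

Lemma ring_unit_root u n :
  (0 < n)%N -> A u -> ring_unit A (u ^+ n) -> ring_unit A u.
Proof.
case: n => // n _ Au [un0 _ Aun].
have u0 : u != 0 by move: un0; rewrite expf_eq0.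
split=> //; have -> : u^-1 = u ^+ n * (u ^+ n.+1)^-1.
  by rewrite exprSr invfM mulrA divff ?mul1r // expf_neq0.
by apply: subringM => //; apply: subringX.
Qed.

End Subring.

(* Zorn's lemma is applied to the family of subrings with the empty set added,
   because the union of the empty chain is empty. *)
Lemma maximal_subring A z : is_subring A -> ~ A z ->
  exists2 M, [/\ is_subring M, (A `<=` M)%classic & ~ M z] &
    forall B, is_subring B -> (M `<=` B)%classic -> ~ B z -> (B `<=` M)%classic.
Proof.
move=> subA Az.
pose good B := [/\ is_subring B, (A `<=` B)%classic & ~ B z].
have [|M [PM maxM]] := @Zorn_bigcup L (fun B => B = set0 \/ good B).
  move=> F PF totF; have [[B FB gB]|nF] := pselect (exists2 B, F B & good B).
    have wit C u : F C -> C u -> good C.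
      by move=> /PF[->|//].
    have join C D u v : F C -> F D -> C u -> D v ->
        exists2 E, F E & good E /\ E u /\ E v.
      move=> FC FD Cu Dv; have [gC gD] := (wit _ _ FC Cu, wit _ _ FD Dv).
      by have [CD|DC] := totF C D FC FD; [exists D | exists C] => //;
        do !split=> //; [apply: CD | apply: DC].
    right; split.
    - have [sB AB nBz] := gB.
      split; first by exists B => //; apply: subring1.
        move=> u v [C FC Cu] [D FD Dv].
        have [E FE [[sE _ _] [Eu Ev]]] := join C D u v FC FD Cu Dv.
        by exists E => //; apply: subringB.
      move=> u v [C FC Cu] [D FD Dv].
      have [E FE [[sE _ _] [Eu Ev]]] := join C D u v FC FD Cu Dv.
      by exists E => //; apply: subringM.
    - by move=> u Au; exists B => //; case: gB => _ + _; apply.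
    - by move=> [C FC Cz]; have [_ _] := wit _ _ FC Cz; apply.
  left; rewrite -subset0 => u [C FC Cu]; apply: nF; exists C => //.
  by case: (PF _ FC) => // C0; rewrite C0 in Cu.
have gM : good M.
  (* If [M] were empty, [A] itself would be a larger member of the family. *)
  case: PM => // M0; exfalso; apply: (maxM A); last by right; split.
  rewrite M0; split; first exact: sub0set.
  by move=> /(_ 1 (subring1 subA)).
exists M => // B sB MB nBz.
apply: contrapT => nBM; apply: (maxM B); first by split.
right; split=> //; case: gM => _ AM _; exact: subset_trans AM MB.
Qed.

Definition is_valuation_ring A : Prop :=
  is_subring A /\ forall u, u != 0 -> A u \/ A u^-1.

(** If [A] contains neither [u] nor [u^-1], maximality puts [z] in both $A[u]$ and $A[u^{-1}]$, say
    $z = p(u) = q(u^{-1})$. The shorter polynomial expresses a power of the variable through lower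
    ones, which shortens the longer polynomial; descent on the total size gives a contradiction. *)
Lemma maximal_subring_valuation A z : is_subring A -> A z^-1 -> ~ A z ->
  (forall B, is_subring B -> (A `<=` B)%classic -> ~ B z -> (B `<=` A)%classic) ->
  is_valuation_ring A.
Proof.
move=> sA Aw nAz maxA; split=> // u u0.
have z0 : z != 0 by apply/eqP => z0; apply: nAz; rewrite z0; apply: subring0.
(* z^-1 lies in the Jacobson radical of A *)
have jac a : A a -> A (1 - z^-1 * a)^-1.
  move=> Aa; set b := 1 - _.
  have Ab : A b by apply: subringB; [|apply: subring1|apply: subringM].
  have b0 : b != 0.
    apply/eqP => /subr0_eq E; apply: nAz.
    by rewrite -[z]mulr1 E mulrA divff // mul1r.
  (* By maximality it is enough that $A[b^{-1}]$ omits [z]. If $z = p(b^{-1})$, then $z b^n$ lies in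
     [A]; since $b^n \in 1 - z^{-1}A$, so does [z]. *)
  apply: (maxA (adjoin A b^-1)); last exact: mem_adjoin.
  - exact: adjoin_subring.
  - exact: sub_adjoin.
  move=> [p Ap zp].
  pose n := size p.
  pose c := \sum_(i < n) p`_i * b ^+ (n - i).
  have Ac : A c.
    apply: subring_sum => // i _; apply: subringM => //.
    exact: subringX.
  have zc : z * b ^+ n = c.
    rewrite zp horner_coef mulr_suml; apply: eq_bigr => i _.
    rewrite -mulrA; congr (_ * _).
    have -> : b ^+ n = b ^+ i * b ^+ (n - i) by rewrite -exprD subnKC // ltnW.
    by rewrite mulrA -exprMn mulVf // expr1n mul1r.
  (* modulo z^-1 A, b is 1 *)
  have [d Ad Ed] : exists2 d, A d & b ^+ n = 1 - z^-1 * d.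
    elim: (n) => [|k [d Ad Ed]].
      by exists 0; [apply: subring0 | rewrite mulr0 subr0].
    exists (d + a - a * z^-1 * d).
      by apply: subringB => //; [apply: subringD | do !apply: subringM].
    by rewrite exprS Ed /b; ring.
  apply: nAz; have -> : z = c + d; last exact: subringD.
  by rewrite -zc Ed mulrBr mulr1 mulrA divff // mul1r subrK.
apply: contrapT => /not_orP[nu nu'].
have gen v : ~ A v -> exists2 p : {poly L}, (forall i, A p`_i) & z = p.[v].
  move=> nAv; suff : adjoin A v z by [].
  apply: contrapT => nz; apply: nAv.
  by apply: (maxA _ (adjoin_subring sA v) (sub_adjoin sA v) nz); apply: mem_adjoin.
have [p Ap zp] := gen _ nu; have [q Aq zq] := gen _ nu'.
have [N] := ubnP (size p + size q).
elim: N => // N IHN in u u0 nu nu' p q Ap Aq zp zq *.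
wlog le_qp : u u0 nu nu' p q Ap Aq zp zq / (size q <= size p)%N.
  move=> IH; case: (leqP (size q) (size p)) => [|/ltnW] le_qp.
    exact: (IH u u0 nu nu' p q).
  by rewrite addnC; apply: (IH u^-1 _ _ _ q p); rewrite ?invr_eq0 ?invrK.
have p0 : (0 < size p)%N.
  rewrite lt0n size_poly_eq0; apply/eqP => p0.
  by move: z0; rewrite zp p0 horner0 eqxx.
pose n := (size p).-1; have sp : size p = n.+1 by rewrite /n prednK.
(* This is $u^n (q(u^{-1}) - q_0)$ as a polynomial in [u]: it is one because [size q <= n.+1], and
   its degree is below [n] because the constant term of [q] is removed. *)
pose r := \poly_(i < n) q`_(n - i).
have ru : r.[u] = u ^+ n * (z - q`_0).
  have le_qn : (size q <= n.+1)%N by rewrite -sp.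
  rewrite zq (horner_coef_wide _ le_qn) big_ord_recl /= expr0 mulr1.
  rewrite addrAC subrr add0r mulr_sumr (horner_coef_wide _ (size_poly _ _)).
  rewrite (reindex_inj rev_ord_inj) /=; apply: eq_bigr => i _.
  rewrite coef_poly ltn_subrL (leq_ltn_trans _ (ltn_ord i)) //= mulrCA.
  have -> : (n - (n - i.+1) = i.+1)%N by have := ltn_ord i; lia.
  have -> : (bump 0 i = i.+1)%N by [].
  congr (_ * _); have -> : u ^+ n = u ^+ (n - i.+1) * u ^+ i.+1 by rewrite -exprD subnK.
  by rewrite -mulrA -exprMn mulfV // expr1n mulr1.
(* In $u^n (z - q_0) = r(u)$ the factor $z - q_0 = z(1 - z^{-1}q_0)$ has its inverse in [A] by
   [jac], so the equation can be solved for $u^n$ over [A]. *)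
pose c := z^-1 * (1 - z^-1 * q`_0)^-1.
have Ac : A c by apply: subringM => //; apply: jac.
have uc : u ^+ n = c * r.[u].
  have Ez : z - q`_0 = z * (1 - z^-1 * q`_0) by rewrite mulrBr mulr1 mulrA divff //
    mul1r.
  have d0 : 1 - z^-1 * q`_0 != 0.
    apply/eqP => d0; apply: nAz; suff -> : z = q`_0 by [].
    by apply/subr0_eq; rewrite Ez d0 mulr0.
  by rewrite ru Ez /c -invfM mulrCA mulVf ?mulr1 // mulf_neq0.
(* Substituting [uc] in the top term of [p] leaves a polynomial of size at most [n] with the same
   value at [u]. *)
move=> lt_N; apply: (IHN u u0 nu nu' (take_poly n p + (p`_n * c) *: r) q) => //.
- move=> i; rewrite coefD coefZ coef_take_poly coef_poly.
  apply: subringD => //; first by case: ifP => // _; apply: subring0.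
  by case: ifP => _; do ?apply: subringM => //; apply: subring0.
- rewrite hornerD hornerZ -mulrA -uc {1}zp -{1}(poly_take_drop n p).
  rewrite hornerD hornerM hornerXn; congr (_ + _ * _).
  rewrite (@horner_coef_wide _ 1) ?size_drop_poly ?sp ?subSnn // big_ord1.
  by rewrite coef_drop_poly expr0 mulr1.
- apply: leq_trans (_ : n + size q < N)%N; last by rewrite sp addSn ltnS in lt_N.
  rewrite ltnS leq_add2r.
  apply: leq_trans (size_polyD _ _) _; rewrite geq_max size_take_poly.
  exact: leq_trans (size_scale_leq _ _) (size_poly _ _).
Qed.

End ValuationRings.

(** * Sums of pairwise nonassociate elements over a valuation ring *)

Section UnitSums.

Variables (L : fieldType) (A : set L) (valA : is_valuation_ring A).

Let sA : is_subring A. Proof. by case: valA. Qed.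

(** A valuation ring is local. If $v/(u+v)$ lies in the ring, it yields the inverse of $u+v$; if its
    inverse does, [v] would be a unit. *)
Lemma ring_unitD u v : ring_unit A u -> A v -> ~ ring_unit A v -> ring_unit A (u + v).
Proof.
move=> Uu Av nUv; have [u0 Au Au'] := Uu.
have [-> | v0] := eqVneq v 0; first by rewrite addr0.
have uv0 : u + v != 0.
  apply/eqP => /addr0_eq uv; apply: nUv; rewrite -uv.
  by split; rewrite ?oppr_eq0 ?invrN //; apply: subringN.
split=> //; first exact: subringD.
have [Aq | Aq] : A (v / (u + v)) \/ A (v / (u + v))^-1.
- by apply: (valA.2); rewrite mulf_neq0 ?invr_eq0.
- have -> : (u + v)^-1 = u^-1 * (1 - v / (u + v)) by field; rewrite uv0.
  by apply: subringM => //; apply: subringB => //; apply: subring1.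
case: nUv; split=> //.
have -> : v^-1 = u^-1 * ((v / (u + v))^-1 - 1) by field; rewrite uv0 v0.
by apply: subringM => //; apply: subringB => //; apply: subring1.
Qed.

(** Ultrametric principle without a value group: divisibility orders the terms totally, and the term
    that strictly divides all others dominates the sum. *)
Lemma sum_associate (I : eqType) (s : seq I) (t : I -> L) :
    s != [::] -> uniq s -> {in s, forall i, t i != 0} ->
    {in s &, forall i j, i != j -> ~ ring_unit A (t i / t j)} ->
  exists2 i, i \in s & ring_unit A ((\sum_(j <- s) t j) / t i).
Proof.
elim: s => // i [_ _ _ t0 _|i' s IHs] /=.
  exists i; rewrite ?mem_seq1 // big_seq1 divff; last by rewrite t0 ?mem_seq1.
  exact: ring_unit1.
set s' := i' :: s in IHs * => _ /andP[nis us] t0 nU.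
have [|||j js'] := IHs _ us.
- by [].
- by move=> j js; rewrite t0 // inE js orbT.
- by move=> j k js ks; apply: nU; rewrite inE ?js ?ks orbT.
rewrite big_cons; set S := \sum_(_ <- s') _ => US.
have ij : i != j by apply: contraNneq nis => ->.
have is' : i \in i :: s' by rewrite mem_head.
have jis : j \in i :: s' by rewrite inE js' orbT.
have [ti0 tj0] := (t0 _ is', t0 _ jis).
have [Aij | Aji] : A (t i / t j) \/ A (t i / t j)^-1.
- by apply: (valA.2); rewrite mulf_neq0 ?invr_eq0.
- exists j => //; rewrite mulrDl addrC; apply: ring_unitD => //.
  exact: nU.
have nUji : ~ ring_unit A (t j / t i) by apply: nU => //; rewrite eq_sym.
exists i => //; rewrite invf_div in Aji.
rewrite mulrDl divff //; have -> : S / t i = S / t j * (t j / t i).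
  by field; rewrite ti0 tj0.
apply: ring_unitD => //; first exact: ring_unit1.
  by apply: subringM => //; case: US.
move=> Uji; apply: nUji.
have -> : t j / t i = (S / t j)^-1 * (S / t j * (t j / t i)).
  by rewrite mulKf //; case: US.
by apply: ring_unitM => //; apply: ring_unitV.
Qed.

End UnitSums.

(** * Discrete valuations *)

Section Valuations.

Variable L : fieldType.
Implicit Types (f g : L).

Definition is_valuation (v : L -> int) : Prop :=
  [/\ v 0 = 0,
      (forall f g, f != 0 -> g != 0 -> v (f * g) = v f + v g) &
      (forall f g, f != 0 -> g != 0 -> f + g != 0 ->
        Order.min (v f) (v g) <= v (f + g))].

Section Theory.

Variables (v : L -> int) (val_v : is_valuation v).

Lemma valuation0 : v 0 = 0. Proof. by case: val_v. Qed.

Lemma valuationM f g : f != 0 -> g != 0 -> v (f * g) = v f + v g.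
Proof. by case: val_v => _ + _; apply. Qed.

Lemma valuationD f g : f != 0 -> g != 0 -> f + g != 0 ->
  Order.min (v f) (v g) <= v (f + g).
Proof. by case: val_v => _ _; apply. Qed.

Lemma valuation1 : v 1 = 0.
Proof.
have := valuationM (oner_neq0 L) (oner_neq0 L); rewrite mulr1 => /eqP.
by rewrite -subr_eq subrr eq_sym => /eqP.
Qed.

Lemma valuationV f : v f^-1 = - v f.
Proof.
have [->|f0] := eqVneq f 0; first by rewrite invr0 valuation0 oppr0.
by apply/eqP; rewrite -addr_eq0 -valuationM ?invr_eq0 // mulVf // valuation1.
Qed.

Lemma valuationX f n : f != 0 -> v (f ^+ n) = n%:Z * v f.
Proof.
move=> f0; elim: n => [|n IHn]; first by rewrite valuation1 mul0r.
by rewrite exprS valuationM ?expf_neq0 // IHn -addn1 PoszD mulrDl mul1r addrC.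
Qed.

Lemma valuationXz f (k : int) : f != 0 -> v (f ^ k) = k * v f.
Proof.
move=> f0; case: k => n; first exact: valuationX.
by rewrite NegzE -invr_expz valuationV -exprnP valuationX // mulNr.
Qed.

Lemma valuationN f : v (- f) = v f.
Proof.
have [->|f0] := eqVneq f 0; first by rewrite oppr0.
have N0 : (-1 : L) != 0 by rewrite oppr_eq0 oner_neq0.
rewrite -mulN1r valuationM //.
have : v ((-1) ^+ 2) = 0 by rewrite sqrrN expr1n valuation1.
by rewrite valuationX //; lia.
Qed.

(** The comparison is guarded by [g != 0] because [v 0] is the junk value 0 instead of $+\infty$. *)
Lemma valuationD_lt f g : f != 0 -> (g != 0 -> v f < v g) ->
  f + g != 0 /\ v (f + g) = v f.
Proof.
move=> f0; have [-> _|g0 /(_ isT) lt_fg] := eqVneq g 0; first by rewrite addr0.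
have fg0 : f + g != 0.
  by apply: contraTneq lt_fg => /addr0_eq <-; rewrite valuationN ltxx.
split=> //; apply/eqP; rewrite eq_le; apply/andP; split; last first.
  by have := valuationD f0 g0 fg0; rewrite (min_idPl (ltW lt_fg)).
have Ng0 : - g != 0 by rewrite oppr_eq0.
have := valuationD fg0 Ng0; rewrite addrK => /(_ f0).
by rewrite valuationN ge_min [v g <= _]leNgt lt_fg orbF.
Qed.

Lemma valuation_sum_dominant (I : finType) (t : I -> L) (i0 : I) :
    t i0 != 0 -> (forall i, i != i0 -> t i != 0 -> v (t i0) < v (t i)) ->
  \sum_i t i != 0 /\ v (\sum_i t i) = v (t i0).
Proof.
move=> t0 lt_t; rewrite (bigD1 i0) //=; apply: valuationD_lt => //.
elim/big_ind: _ => [|f g Hf Hg fg0|i ii0]; first by rewrite eqxx.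
  have [f0|f0] := eqVneq f 0; first by rewrite f0 add0r in fg0 *; apply: Hg.
  have [g0|g0] := eqVneq g 0; first by rewrite g0 addr0 in fg0 *; apply: Hf.
  apply: lt_le_trans (valuationD f0 g0 fg0).
  by rewrite lt_min Hf // Hg.
exact: lt_t.
Qed.

End Theory.

(** The values form a nonzero subgroup of the integers; dividing by its least positive element makes
    the valuation onto. *)
Lemma normalized_valuation (w : L -> int) :
    is_valuation w -> (exists2 t, t != 0 & 0 < w t) ->
  exists v : L -> int, [/\ is_valuation v, (exists t, t != 0 /\ v t = 1)
    & exists2 d : int, 0 < d & forall f, w f = d * v f].
Proof.
move=> val_w [t0 t00 wt0].
(* The shift by one makes [ex_minnP] return the least positive value. *)
pose Q n := `[< exists2 t, t != 0 & w t = n.+1%:Z >].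
have exQ : exists n, Q n.
  exists `|w t0|.-1%N; apply/asboolP; exists t0 => //.
  by rewrite prednK; lia.
have [d /asboolP[t t_0 wt] dmin] := ex_minnP exQ.
pose D : int := d.+1%:Z.
have D_gt0 : 0 < D by [].
have dvd f : w f = D * (w f %/ D)%Z.
  have [->|f0] := eqVneq f 0; first by rewrite (valuation0 val_w) div0z mulr0.
  suff r0 : (w f %% D)%Z = 0 by rewrite [LHS](divz_eq _ D) r0 addr0 mulrC.
  (* A nonzero remainder would be the value of [g], positive and smaller than the least one. *)
  apply/eqP; apply: contraT => r0; pose g := f * t ^ (- (w f %/ D)%Z).
  have g0 : g != 0 by rewrite mulf_neq0 // expfz_neq0.
  have wg : w g = (w f %% D)%Z.
    by rewrite (valuationM val_w) ?expfz_neq0 // (valuationXz val_w) // wt -/D mulNr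
      {1}(divz_eq (w f) D); ring.
  have r_ge0 : 0 <= (w f %% D)%Z by rewrite modz_ge0.
  have r_lt : (w f %% D)%Z < D by rewrite ltz_pmod.
  have := dmin (`|w g|.-1)%N; rewrite -/D in wt *.
  suff Qg : Q (`|w g|.-1)%N by move/(_ Qg); rewrite /D in r_lt; lia.
  apply/asboolP; exists g => //; rewrite prednK; lia.
have cancelD (u v : int) : (D * u <= D * v) = (u <= v) by rewrite ler_pM2l.
have DI : injective ( *%R D) by apply: mulfI; rewrite gt_eqF.
pose v f := (w f %/ D)%Z.
have v0 : v 0 = 0 by rewrite /v (valuation0 val_w) div0z.
have vM f g : f != 0 -> g != 0 -> v (f * g) = v f + v g.
  by move=> f0 g0; apply: DI; rewrite /= mulrDr -!dvd (valuationM val_w).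
have vD f g : f != 0 -> g != 0 -> f + g != 0 -> Order.min (v f) (v g) <= v (f + g).
  by move=> f0 g0 fg0; have := valuationD val_w f0 g0 fg0;
    rewrite !ge_min (dvd f) (dvd g) (dvd (f + g)) !cancelD.
have vt : v t = 1 by rewrite /v wt divzz.
by exists v; split=> //; [exists t | exists D].
Qed.

End Valuations.

(** * The discrete valuation of a valuation ring containing $K[x]$ *)

Section PlaceOfValuationRing.

Variables (K : closedFieldType) (L : fieldType) (phi : {rmorphism {poly K} -> L}).
Hypothesis phi_inj : injective phi.
Variable D : nat.
Hypothesis phi_alg : forall f : L, exists2 p : {poly L},
  [/\ p != 0, (size p <= D.+1)%N & root p f] &
  forall i, exists a b : {poly K}, b != 0 /\ p`_i = phi a / phi b.
Variables (A : set L) (valA : is_valuation_ring A).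
Hypothesis A_poly : forall a : {poly K}, A (phi a).

Let phi_eq0 a : (phi a == 0) = (a == 0).
Proof. exact: raddf_eq0. Qed.

Let sA : is_subring A. Proof. by case: valA. Qed.

(** In the vanishing sum $p(f) = 0$ two nonzero terms are associate, since otherwise [sum_associate]
    would make the sum nonzero. Their quotient is a power of [f] times a fraction, and the degree
    bound on [p] bounds the exponent. *)
Lemma power_associate (f : L) : f != 0 ->
  exists n (a b : {poly K}),
    [/\ (0 < n <= D)%N, a != 0, b != 0
      & ring_unit A (f ^+ n * (phi a / phi b))].
Proof.
move=> f0; have [p [p0 sp /rootP pf0] p_base] := phi_alg f; pose t i := p`_i * f ^+ i.
pose s := [seq i <- iota 0 (size p) | p`_i != 0].
have [i [j [pi0 pj0 lt_ij lt_j Uij]]] : exists i j,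
  [/\ p`_i != 0, p`_j != 0, (i < j)%N, (j < size p)%N &
    ring_unit A (t j / t i)].
  apply: contrapT => nex.
  have [||||i is0] := @sum_associate L A valA _ s t.
  - apply/eqP => s0.
    have : (size p).-1 \in s.
      by rewrite mem_filter mem_iota -lead_coefE lead_coef_eq0 p0 add0n ltn_predL
        size_poly_gt0.
    by rewrite s0.
  - by rewrite filter_uniq ?iota_uniq.
  - by move=> i; rewrite mem_filter => /andP[pi0 _]; rewrite mulf_neq0 ?expf_neq0.
  - move=> i j; rewrite !mem_filter !mem_iota !add0n.
    move=> /andP[pi0 /= lti] /andP[pj0 /= ltj] ij Uij; apply: nex.
    have [ltij|ltji] : (i < j)%N \/ (j < i)%N by apply/orP; rewrite -neq_ltn.
      exists i, j; split=> //; rewrite -[t j / t i]invrK invf_div.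
      exact: ring_unitV.
    by exists j, i.
  have -> : \sum_(j <- s) t j = 0.
    rewrite big_filter -[RHS]pf0 horner_coef -(big_mkord xpredT t).
    rewrite /index_iota subn0 [RHS](bigID (fun i => p`_i != 0)) /=.
    rewrite [X in _ = _ + X]big1 ?addr0 // => k; rewrite negbK => /eqP pk0.
    by rewrite /t pk0 mul0r.
  by rewrite mul0r => -[]; rewrite eqxx.
have [a [b [b0 Ei]]] := p_base i; have [c [d [d0 Ej]]] := p_base j.
have a0 : a != 0 by apply: contraNneq pi0 => a0; rewrite Ei a0 rmorph0 mul0r.
have c0 : c != 0 by apply: contraNneq pj0 => c0; rewrite Ej c0 rmorph0 mul0r.
exists (j - i)%N, (c * b), (d * a); split; rewrite ?mulf_neq0 //.
  rewrite subn_gt0 lt_ij /= (leq_trans (leq_subr _ _)) // -ltnS.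
  exact: leq_trans lt_j sp.
suff <- : t j / t i = f ^+ (j - i) * (phi (c * b) / phi (d * a)) by [].
have fj : f ^+ j = f ^+ (j - i) * f ^+ i by rewrite -exprD subnK // ltnW.
rewrite /t fj Ei Ej !rmorphM /=.
field; rewrite expf_neq0 // !phi_eq0.
by rewrite a0 b0 d0.
Qed.

Lemma const_unit (c : K) : c != 0 -> ring_unit A (phi c%:P).
Proof.
move=> c0; split; rewrite ?phi_eq0 ?polyC_eq0 //.
have -> : (phi c%:P)^-1 = phi (c^-1)%:P; last exact: A_poly.
apply: (mulfI (_ : phi c%:P != 0)); first by rewrite phi_eq0 polyC_eq0.
by rewrite divff ?phi_eq0 ?polyC_eq0 // -rmorphM /= -polyCM divff // rmorph1.
Qed.

Lemma poly_units :
  (forall b : K, ring_unit A (phi ('X - b%:P))) ->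
  forall a : {poly K}, a != 0 -> ring_unit A (phi a).
Proof.
move=> Ulin a a0; have [s Ea] := closed_field_poly_normal a.
rewrite Ea -mul_polyC rmorphM rmorph_prod.
apply: ring_unitM => //; first by apply: const_unit; rewrite lead_coef_eq0.
by elim/big_ind: _ => [|u v Uu Uv|i _];
  [apply: ring_unit1|apply: ring_unitM|apply: Ulin].
Qed.

(** If every $X - b$ were a unit, all nonzero polynomials would be, hence also some power of [z] by
    [power_associate], and then [z] would lie in [A]. *)
Lemma valuation_ring_center z : ~ A z ->
  exists b : K, ~ ring_unit A (phi ('X - b%:P)).
Proof.
move=> nAz; have z0 : z != 0.
  by apply/eqP => z0; apply: nAz; rewrite z0; apply: subring0.
apply/existsNP => Ulin; have Up := poly_units Ulin.
have [n [a [b [/andP[n_gt0 _] a0 b0 Uz]]]] := power_associate z0.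
have Uab : ring_unit A (phi a / phi b).
  by apply: ring_unitM => //; [|apply: ring_unitV]; apply: Up.
have : ring_unit A (z^-1 ^+ n).
  rewrite exprVn -[z ^+ n](mulfK (_ : phi a / phi b != 0)); last by case: Uab.
  by apply/ring_unitV/ring_unitM => //; apply: ring_unitV.
move=> Uzn; have [//|Az'] := valA.2 _ z0.
by apply: nAz; have [] := ring_unit_root sA n_gt0 Az' Uzn; rewrite invrK.
Qed.

Section Order.

Variables (b : K) (Xb_nonunit : ~ ring_unit A (phi ('X - b%:P))).

Local Notation pi := (phi ('X - b%:P)).

Let pi0 : pi != 0. Proof. by rewrite phi_eq0 polyXsubC_eq0. Qed.

Lemma unit_pi_exp (k : int) : A (pi ^ k) -> 0 <= k.
Proof.
case: k => // n; rewrite NegzE => An; case: Xb_nonunit.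
split=> //; have -> : pi^-1 = pi ^+ n * pi ^ (- n.+1%:Z).
  rewrite exprnP -expfzDr // -[LHS]exprN1; congr (_ ^ _); lia.
by apply: subringM => //; apply: subringX.
Qed.

(** Only the linear factors equal to $X - b$ count: for $c \neq b$, $X - c$ is the unit $b - c$ plus
    the nonunit $X - b$. *)
Lemma poly_order (a : {poly K}) : a != 0 ->
  exists k : int, ring_unit A (phi a * pi ^ k).
Proof.
move=> a0; have [s Ea] := closed_field_poly_normal a.
rewrite Ea -mul_polyC rmorphM rmorph_prod.
have [k Uk] : exists k : int, ring_unit A ((\prod_(c <- s) phi ('X - c%:P)) * pi ^ k).
  elim: s {Ea} => [|c s [k Uk]].
    by exists 0; rewrite big_nil mulr1; apply: ring_unit1.
  rewrite big_cons; have [-> | cb] := eqVneq c b.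
    exists (k - 1); suff -> : pi * (\prod_(c <- s) phi ('X - c%:P)) * pi ^ (k - 1) =
       (\prod_(c <- s) phi ('X - c%:P)) * pi ^ k by [].
    by rewrite expfzDr // exprN1 [pi * _]mulrC -mulrA [pi * (_ / pi)]mulrCA mulfV
      ?mulr1.
  exists k; rewrite -mulrA; apply: ring_unitM => //.
  have -> : 'X - c%:P = (b - c)%:P + ('X - b%:P) by rewrite polyCB; ring.
  rewrite rmorphD; apply: (ring_unitD valA _ (A_poly _) Xb_nonunit).
  by apply: const_unit; rewrite subr_eq0 eq_sym.
exists k; rewrite -mulrA; apply: ring_unitM => //.
by apply: const_unit; rewrite lead_coef_eq0.
Qed.

(** Every exponent supplied by [power_associate] is at most [D], hence divides $D!$; one fixed power
    therefore gives every element an integral order. *)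
Let N := (D)`!.

Lemma order_exists (f : L) : f != 0 -> exists k : int, ring_unit A (f ^+ N * pi ^ k).
Proof.
move=> f0; have [n [c [d [/andP[n_gt0 le_n] c0 d0 Uf]]]] := power_associate f0.
have [kc Uc] := poly_order c0; have [kd Ud] := poly_order d0.
have [l EN] : exists l, N = (n * l)%N.
  have /dvdnP[l E] : (n %| N)%N by rewrite dvdn_fact ?n_gt0.
  by exists l; rewrite mulnC.
exists ((kd - kc) * l%:Z); rewrite EN exprM -exprz_exp -exprnP -exprMn.
apply: ring_unitX => //.
have C0 : phi c != 0 by rewrite phi_eq0.
have D0 : phi d != 0 by rewrite phi_eq0.
have -> : f ^+ n * pi ^ (kd - kc) = f ^+ n * (phi c / phi d) * (phi c * pi ^ kc)^-1 *
  (phi d * pi ^ kd).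
  rewrite expfzDr // -invr_expz; have := expfz_neq0 kc pi0.
  by move: (pi ^ kc) (pi ^ kd) (f ^+ n) => u v g u0; field; rewrite u0 C0 D0.
by apply: ring_unitM => //; apply: ring_unitM => //; apply: ring_unitV.
Qed.

(** This is $D!$ times the valuation at which [pi] has value 1, so it need not be normalized. For
    [f != 0] the exponent exists by [order_exists], and [unit_pi_exp] makes it unique. *)
Definition pi_order (f : L) : int :=
  if f == 0 then 0 else - xget 0 [set k : int | ring_unit A (f ^+ N * pi ^ k)]%classic.

Lemma pi_orderP (f : L) : f != 0 -> ring_unit A (f ^+ N * pi ^ (- pi_order f)).
Proof.
move=> f0; rewrite /pi_order (negbTE f0) opprK.
case: xgetP => [x ->|/= nex]; first by [].
by have [k /nex] := order_exists f0.
Qed.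

Lemma pi_order_eq (f : L) (k : int) : f != 0 -> ring_unit A (f ^+ N * pi ^ (- k)) ->
  pi_order f = k.
Proof.
move=> f0 Uk; have := pi_orderP f0; set k' := pi_order f => Uk'.
have F0 : f ^+ N != 0 by rewrite expf_neq0.
have E (u v : int) : pi ^ (u - v) = f ^+ N * pi ^ (- v) * (f ^+ N * pi ^ (- u))^-1.
  rewrite expfzDr // -!invr_expz; have [] := (expfz_neq0 u pi0, expfz_neq0 v pi0).
  by move: (pi ^ u) (pi ^ v) (f ^+ N) F0 => x y g g0 x0 y0; field; rewrite g0 x0 y0.
apply/eqP; rewrite eq_le -subr_ge0 -[k <= _]subr_ge0; apply/andP; split;
  apply: unit_pi_exp; rewrite E.
  by have [] := ring_unitM sA Uk' (ring_unitV Uk).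
by have [] := ring_unitM sA Uk (ring_unitV Uk').
Qed.

Lemma pi_orderM (f g : L) : f != 0 -> g != 0 ->
  pi_order (f * g) = pi_order f + pi_order g.
Proof.
move=> f0 g0; apply: pi_order_eq; first by rewrite mulf_neq0.
by rewrite opprD expfzDr // exprMn mulrACA; apply: ring_unitM => //; apply: pi_orderP.
Qed.

Lemma pi_order_ge0 (f : L) : f != 0 -> A f -> 0 <= pi_order f.
Proof.
move=> f0 Af; apply: unit_pi_exp.
have -> : pi ^ pi_order f = (f ^+ N * pi ^ (- pi_order f))^-1 * f ^+ N.
  rewrite -invr_expz; have [] := (expfz_neq0 (pi_order f) pi0, expf_neq0 N f0).
  by move: (pi ^ _) (f ^+ N) => x g x0 g0; field; rewrite x0 g0.
apply: subringM => //; last exact: subringX.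
by have [] := pi_orderP f0.
Qed.

Lemma pi_orderD (f g : L) : f != 0 -> g != 0 -> f + g != 0 ->
  Order.min (pi_order f) (pi_order g) <= pi_order (f + g).
Proof.
move=> f0 g0 fg0.
wlog Afg : f g f0 g0 fg0 / A (f / g).
  move=> IH; have [|Afg|] := valA.2 (f / g); first by rewrite mulf_neq0 ?invr_eq0.
    exact: IH.
  by rewrite invf_div minC addrC; apply: IH; rewrite // addrC.
rewrite ge_min; apply/orP; right.
have -> : f + g = g * (f / g + 1) by field.
have q0 : f / g + 1 != 0.
  by apply: contraNneq fg0 => q0; rewrite -[f + g](mulfVK g0) mulrDl divff // q0 mul0r.
rewrite pi_orderM // lerDl; apply: pi_order_ge0 => //.
by apply: subringD => //; apply: subring1.
Qed.

Lemma pi_order_unit f : ring_unit A f -> pi_order f = 0.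
Proof.
move=> Uf; apply: pi_order_eq; first by case: Uf.
by rewrite oppr0 mulr1; apply: ring_unitX.
Qed.

Lemma pi_order_pi : pi_order pi = N%:Z.
Proof.
apply: pi_order_eq => //; rewrite exprnP -expfzDr // subrr expr0z.
exact: ring_unit1.
Qed.

Lemma pi_order_gt0 (f : L) : f != 0 -> A f -> ~ ring_unit A f -> 0 < pi_order f.
Proof.
move=> f0 Af nUf; rewrite lt_neqAle pi_order_ge0 // andbT eq_sym; apply/eqP => o0.
have := pi_orderP f0; rewrite o0 oppr0 mulr1 => UfN.
by apply: nUf; apply: ring_unit_root UfN => //; apply: fact_gt0.
Qed.

Lemma pi_order_valuation : is_valuation pi_order.
Proof. by split; [rewrite /pi_order eqxx | apply: pi_orderM | apply: pi_orderD]. Qed.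

End Order.

End PlaceOfValuationRing.

(** * Nonintegral elements have a pole *)

Section IntegralClosure.

Lemma integral_exp (R : comNzRingType) (L : fieldType) (phi : {rmorphism R -> L})
  (z : L) n :
  integralOver phi z -> integralOver phi (z ^+ n).
Proof.
move=> intz; elim: n => [|n IHn]; first exact: integral1.
by rewrite exprS; apply: integral_mul.
Qed.

(** A relation $z = p(z^{-1})$ multiplied by $z^n$, with [n] the size of [p], is a monic equation of
    degree $n + 1$ for [z]. *)
Lemma nonintegral_adjoin_inv (R : comNzRingType) (L : fieldType)
  (phi : {rmorphism R -> L}) (z : L) :
  ~ integralOver phi z -> ~ adjoin (range phi) z^-1 z.
Proof.
move=> nint [p Ap zp]; apply: nint.
have z0 : z != 0 \/ integralOver phi z.
  by have [->|] := eqVneq z 0; [right; apply: integral0 | left].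
case: z0 => // z0.
pose n := size p; pose r := \poly_(i < n.+1) p`_(n - i).
have ip i : integralOver phi p`_i by have [a _ <-] := Ap i; apply: integral_id.
have rz : r.[z] = z ^+ n * z.
  have zE : z = \sum_(i < n.+1) p`_i * z^-1 ^+ i.
    by rewrite {1}zp; apply: horner_coef_wide; apply: leqnSn.
  rewrite [X in _ = _ * X]zE (horner_coef_wide _ (size_poly _ _)) mulr_sumr.
  rewrite (reindex_inj rev_ord_inj) /=; apply: eq_bigr => i _.
  rewrite coef_poly subSS ltnS leq_subr subKn ?leq_ord // mulrCA; congr (_ * _).
  have -> : z ^+ n = z ^+ (n - i) * z ^+ i by rewrite -exprD subnK ?leq_ord.
  by rewrite -mulrA -exprMn mulfV // expr1n mulr1.
have sr : (size (- r) < size ('X^(n.+1) : {poly L}))%N.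
  by rewrite size_polyXn size_polyN ltnS size_poly.
apply: (@integral_root_monic _ _ _ z ('X^(n.+1) - r)).
- by rewrite monicE lead_coefDl // lead_coefXn.
- by rewrite rootE !hornerE rz exprSr subrr.
apply/integral_poly => i; rewrite coefB coefXn coef_poly.
by apply: integral_sub; [exact: integral_nat | case: ifP => _; [|exact: integral0]].
Qed.

Variables (K : closedFieldType) (L : fieldType) (phi : {rmorphism {poly K} -> L}).
Hypothesis phi_inj : injective phi.
Variable D : nat.
Hypothesis phi_alg : forall f : L, exists2 p : {poly L},
  [/\ p != 0, (size p <= D.+1)%N & root p f] &
  forall i, exists a b : {poly K}, b != 0 /\ p`_i = phi a / phi b.

Let phi_eq0 a : (phi a == 0) = (a == 0).
Proof. exact: raddf_eq0. Qed.

Lemma nonintegral_valuation z : ~ integralOver phi z ->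
  exists v : L -> int, [/\ is_valuation v, (exists t, t != 0 /\ v t = 1),
    (forall c, v (phi c%:P) = 0), 0 <= v (phi 'X) & v z < 0].
Proof.
move=> nint; have z0 : z != 0.
  by apply/eqP => z0; apply: nint; rewrite z0; apply: integral0.
have sA0 : is_subring (range phi).
  split; first by exists 1; rewrite ?rmorph1.
    by move=> _ _ [a _ <-] [b _ <-]; exists (a - b); rewrite ?rmorphB.
  by move=> _ _ [a _ <-] [b _ <-]; exists (a * b); rewrite ?rmorphM.
have [A [sA A0A nAz] maxA] :=
  maximal_subring (adjoin_subring sA0 _) (nonintegral_adjoin_inv nint).
have Aw : A z^-1 by apply: A0A; apply: mem_adjoin.
have valA := maximal_subring_valuation sA Aw nAz maxA.
have Ap a : A (phi a) by apply: A0A; apply: sub_adjoin => //; exists a.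
have [b nU] := valuation_ring_center phi_inj phi_alg valA Ap nAz.
have [|v [val_v v1 [d d0 vE]]] :=
    normalized_valuation (pi_order_valuation phi_inj phi_alg valA Ap nU).
  exists (phi ('X - b%:P)); first by rewrite phi_eq0 polyXsubC_eq0.
  by rewrite pi_order_pi // ltz_nat fact_gt0.
have vd f : v f = 0 <-> pi_order phi D A b f = 0.
  by rewrite vE; split=> [->|/eqP]; rewrite ?mulr0 // mulf_eq0 gt_eqF //= => /eqP.
exists v; split=> //.
- move=> c; have [->|c0] := eqVneq c 0; first by rewrite rmorph0 valuation0.
  by apply/vd/pi_order_unit => //; apply: const_unit.
- rewrite -(pmulr_rge0 _ d0) -vE; apply: pi_order_ge0 => //.
  by rewrite phi_eq0 polyX_eq0.
have : 0 < pi_order phi D A b z^-1.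
  apply: (pi_order_gt0 phi_inj phi_alg valA Ap nU) => //; first by rewrite invr_eq0.
  by move=> [_ _]; rewrite invrK.
by rewrite vE (valuationV val_v) mulrN oppr_gt0 pmulr_rlt0.
Qed.

End IntegralClosure.

(** * Values of polynomials in [x] *)

Section PolyValuation.

Variables (K : closedFieldType) (L : fieldType) (phi : {rmorphism {poly K} -> L}).
Hypothesis phi_inj : injective phi.
Variables (v : L -> int) (val_v : is_valuation v).
Hypothesis v_const : forall c, v (phi c%:P) = 0.

Let phi_eq0 a : (phi a == 0) = (a == 0).
Proof. exact: raddf_eq0. Qed.

Lemma valuation_poly_ge0 (a : {poly K}) : 0 <= v (phi 'X) -> 0 <= v (phi a).
Proof.
move=> vX; elim/poly_ind: a => [|a c IHa]; first by rewrite rmorph0 valuation0.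
have [->|a0] := eqVneq a 0; first by rewrite mul0r add0r v_const.
have X0 : 'X != 0 :> {poly K} by rewrite polyX_eq0.
have vaX : 0 <= v (phi (a * 'X)).
  by rewrite rmorphM (valuationM val_v) ?phi_eq0 // addr_ge0.
have [->|c0] := eqVneq c 0; first by rewrite addr0.
have [->|ac0] := eqVneq (a * 'X + c%:P) 0; first by rewrite rmorph0 valuation0.
rewrite rmorphD; apply: le_trans (valuationD val_v _ _ _).
- by rewrite le_min vaX v_const lexx.
- by rewrite phi_eq0 mulf_neq0.
- by rewrite phi_eq0 polyC_eq0.
- by rewrite -rmorphD phi_eq0.
Qed.

(** Where [x] has a pole the leading term dominates. *)
Lemma valuation_poly_lt0 (a : {poly K}) : v (phi 'X) < 0 -> a != 0 ->
  v (phi a) = (size a).-1%:Z * v (phi 'X).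
Proof.
move=> vX; elim/poly_ind: a => [|a c IHa]; first by rewrite eqxx.
have [->|a0 _] := eqVneq a 0.
  by rewrite mul0r add0r v_const size_polyC; case: (c != 0); rewrite /= mul0r.
have X0 : 'X != 0 :> {poly K} by rewrite polyX_eq0.
have vaX : v (phi (a * 'X)) = (size a)%:Z * v (phi 'X).
  rewrite rmorphM (valuationM val_v) ?phi_eq0 // IHa //.
  have sa : (0 < size a)%N by rewrite size_poly_gt0.
  have -> : ((size a).-1)%:Z = (size a)%:Z - 1 by lia.
  by rewrite mulrBl mul1r subrK.
rewrite size_MXaddC (negbTE a0) /= -vaX rmorphD.
apply: (valuationD_lt val_v _ _).2; first by rewrite phi_eq0 mulf_neq0.
by move=> _; rewrite v_const vaX nmulr_llt0 // ltz_nat size_poly_gt0.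
Qed.

End PolyValuation.

(** * Kummer extensions *)

Section Kummer.

Variables (K : closedFieldType) (L : fieldType) (phi : {rmorphism {poly K} -> L}).
Hypothesis phi_inj : injective phi.
Variables (m : nat) (f : {poly K}) (y : L).
Hypotheses (m_gt0 : (0 < m)%N) (f0 : f != 0) (y_eq : y ^+ m = phi f).

Let phi_eq0 a : (phi a == 0) = (a == 0).
Proof. exact: raddf_eq0. Qed.

Let y0 : y != 0.
Proof. by have := f0; rewrite -phi_eq0 -y_eq expf_eq0 m_gt0. Qed.

Definition infinite_valuation (v : L -> int) : Prop :=
  [/\ is_valuation v, (forall c, v (phi c%:P) = 0) & v (phi 'X) < 0].

Definition kterm (a b : {poly K}) (j : nat) : L := phi a / phi b * y ^+ j.

(* The pole order of [kterm a b j] at infinity: the offsets of the two sizes from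
   the degrees cancel. *)
Definition kdeg (a b : {poly K}) (j : nat) : int :=
  m%:Z * ((size a)%:Z - (size b)%:Z) + j%:Z * ((size f).-1)%:Z.

Lemma kterm_eq0 a b j : b != 0 -> (kterm a b j == 0) = (a == 0).
Proof.
by move=> b0; rewrite /kterm !mulf_eq0 invr_eq0 !phi_eq0 (negbTE b0) expf_eq0 (negbTE
  y0) andbF !orbF.
Qed.

Lemma infinite_valuation_y v : infinite_valuation v ->
  m%:Z * v y = v (phi 'X) * ((size f).-1)%:Z.
Proof.
move=> [val_v vC vX]; rewrite -(valuationX val_v) // y_eq.
by rewrite (valuation_poly_lt0 phi_inj) // mulrC.
Qed.

(** The factor [m] avoids a division: [v y] is known only through $m\,v(y) = v(y^m)$. *)
Lemma infinite_valuation_kterm v a b j : infinite_valuation v -> a != 0 -> b != 0 ->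
  m%:Z * v (kterm a b j) = v (phi 'X) * kdeg a b j.
Proof.
move=> inf_v a0 b0; have [val_v vC vX] := inf_v.
rewrite /kterm (valuationM val_v) ?mulf_neq0 ?invr_eq0 ?expf_neq0 ?phi_eq0 //.
rewrite (valuationX val_v) // (valuationM val_v) ?invr_eq0 ?phi_eq0 // (valuationV
  val_v).
rewrite (valuation_poly_lt0 phi_inj val_v vC vX a0) (valuation_poly_lt0 phi_inj val_v
  vC vX b0).
rewrite mulrDr mulrCA (infinite_valuation_y inf_v).
have [sa sb] : (0 < size a)%N /\ (0 < size b)%N by rewrite !size_poly_gt0.
have -> : ((size a).-1)%:Z = (size a)%:Z - 1 by lia.
have -> : ((size b).-1)%:Z = (size b)%:Z - 1 by lia.
by rewrite /kdeg; ring.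
Qed.

Hypothesis coprime_deg : coprime m (size f).-1.

(** Modulo [m] the degree is $j \deg f$ with $\deg f$ prime to [m], which determines $j < m$. *)
Lemma kdeg_inj a b a' b' (j k : 'I_m) : kdeg a b j = kdeg a' b' k -> j = k.
Proof.
rewrite /kdeg => E; apply/val_inj/eqP => /=.
wlog le_jk : a b a' b' j k E / (j <= k)%N.
  by move=> IH; case/orP: (leq_total j k) => /IH; [|rewrite eq_sym]; eauto.
have : (m %| (k - j) * (size f).-1)%N.
  have Ez : ((k - j) * (size f).-1)%N%:Z
      = m%:Z * ((size a)%:Z - (size b)%:Z - ((size a')%:Z - (size b')%:Z)).
    by rewrite PoszM -subzn // mulrBl; lia.
  by rewrite -[X in (_ %| X)%N]absz_nat Ez abszM dvdn_mulr.
rewrite Gauss_dvdl // => /dvdn_leq le_m; rewrite eqn_leq le_jk /= leqNgt.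
apply/negP => lt_jk; have := le_m; rewrite subn_gt0 lt_jk => /(_ isT).
by have := ltn_ord k; lia.
Qed.

(** The index [j] maximizing [kdeg] is chosen before [v]. One dominant component thus serves all
    valuations at infinity, which is what their uniqueness rests on. *)
Lemma infinite_valuation_sum (a b : 'I_m -> {poly K}) :
    (forall j, b j != 0) -> (exists j, a j != 0) ->
  exists2 j : 'I_m, a j != 0 & forall v, infinite_valuation v ->
    \sum_i kterm (a i) (b i) i != 0 /\
    m%:Z * v (\sum_i kterm (a i) (b i) i) = v (phi 'X) * kdeg (a j) (b j) j.
Proof.
move=> b0 [j0 aj0].
case: (@arg_maxP _ _ _ j0 (fun j => a j != 0) (fun j => kdeg (a j) (b j) j) aj0)
  => j aj max_j.
exists j => // v inf_v; have [val_v vC vX] := inf_v.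
have mP : (0 : int) < m by [].
have [] := @valuation_sum_dominant _ v val_v _ (fun i => kterm (a i) (b i) i) j.
- by rewrite kterm_eq0.
- move=> i ij; rewrite kterm_eq0 // => ai.
  rewrite -(ltr_pM2l mP) !(infinite_valuation_kterm _ inf_v) // ltr_nM2l //.
  have le_ij : kdeg (a i) (b i) i <= kdeg (a j) (b j) j by apply: max_j.
  by rewrite lt_neqAle le_ij andbT; apply: contra ij => /eqP/kdeg_inj ->.
by move=> s0 ->; rewrite (infinite_valuation_kterm _ inf_v).
Qed.

Hypothesis kexpand : forall z : L, exists a b : 'I_m -> {poly K},
  (forall j, b j != 0) /\ z = \sum_j kterm (a j) (b j) j.

Lemma kexpand_neq0 z : z != 0 -> exists a b : 'I_m -> {poly K},
  [/\ (forall j, b j != 0), (exists j, a j != 0) & z = \sum_j kterm (a j) (b j) j].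
Proof.
move=> z0; have [a [b [b0 Ez]]] := kexpand z; exists a, b; split=> //.
apply: contrapT => /forallNP a0; case/eqP: z0; rewrite Ez big1 // => j _.
by apply/eqP; rewrite kterm_eq0 //; apply/negPn/negP/a0.
Qed.

(* By [infinite_valuation_y] and coprimality m divides v(x); it is no larger
   since v is onto. *)
Lemma infinite_valuation_x v : infinite_valuation v ->
  (exists t, t != 0 /\ v t = 1) -> v (phi 'X) = - m%:Z.
Proof.
move=> inf_v [t [t0 vt]]; have [val_v vC vX] := inf_v.
have [a [b [b0 a0 Et]]] := kexpand_neq0 t0.
have [j _ /(_ v inf_v)[_]] := infinite_valuation_sum b0 a0.
rewrite -Et vt mulr1 => Em.
have dvd1 : (`|v (phi 'X)| %| m)%N.
  by rewrite -[X in (_ %| X)%N]absz_nat Em abszM dvdn_mulr.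
have dvd2 : (m %| `|v (phi 'X)|)%N.
  rewrite -(Gauss_dvdl _ coprime_deg) -[(size f).-1]absz_nat -abszM.
  by rewrite -(infinite_valuation_y inf_v) abszM dvdn_mulr.
have : `|v (phi 'X)|%N = m by apply/eqP; rewrite eqn_dvd dvd1.
by move: vX; lia.
Qed.

Lemma infinite_valuation_unique v v' f' :
  infinite_valuation v -> infinite_valuation v' ->
  (exists t, t != 0 /\ v t = 1) -> (exists t, t != 0 /\ v' t = 1) ->
  f' != 0 -> v f' = v' f'.
Proof.
move=> inf_v inf_v' v1 v1' f'0.
have [a [b [b0 a0 Et]]] := kexpand_neq0 f'0.
have [j _ vE] := infinite_valuation_sum b0 a0.
have mP : m%:Z != 0 by lia.
apply: (mulfI mP); rewrite Et (vE _ inf_v).2 (vE _ inf_v').2.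
by rewrite !infinite_valuation_x.
Qed.

End Kummer.

(** * Divisibility and integrality for polynomials over an algebraically closed field *)

Section PolyClosed.

Variable K : closedFieldType.

Lemma closed_size1 (b : {poly K}) : b != 0 -> (forall x, ~ root b x) -> size b = 1%N.
Proof.
move=> b0 nroot; apply/eqP/negPn/negP => /closed_rootP[x bx].
exact: nroot bx.
Qed.

Lemma closed_primitive_root n : (0 < n)%N -> n%:R != 0 :> K ->
  exists z : K, n.-primitive_root z.
Proof.
move=> n_gt0 n0; have [s Es] := closed_field_poly_normal ('X^n - 1 : {poly K}).
have lc : lead_coef ('X^n - 1 : {poly K}) = 1 by apply/eqP;
  rewrite -monicE monic_Xn_sub_1.
rewrite lc scale1r in Es.
have ss : size s = n by apply: succn_inj;
  rewrite -(size_prod_XsubC s id) -Es size_Xn_sub_1.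
have us : uniq s by rewrite -separable_prod_XsubC -Es cyclotomic.separable_Xn_sub_1.
have rs : all n.-unity_root s.
  by apply/allP => z zs; rewrite unity_rootE -subr_eq0; have := root_prod_XsubC s z;
    rewrite zs -Es rootE !hornerE => ->.
have [z] := hasP (cyclic.has_prim_root n_gt0 rs us (eq_leq (esym ss))).
by exists z.
Qed.

(** Let $A'$, $b'$ be the quotients by the gcd. At a root [x] of $b'$, $(X-x)^m$ divides $A'^m R$
    and is prime to $A'$, so it would divide [R]. Hence $b'$ is constant. *)
Lemma dvdp_of_exp (m : nat) (A R H b : {poly K}) : b != 0 ->
    (forall x, ~~ (('X - x%:P) ^+ m %| R)) -> A ^+ m * R = H * b ^+ m ->
  b %| A.
Proof.
move=> b0 nR E; pose g := gcdp A b.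
have g0 : g != 0 by rewrite gcdp_eq0 negb_and b0 orbT.
have EA : A = A %/ g * g by rewrite divpK // dvdp_gcdl.
have Eb : b = b %/ g * g by rewrite divpK // dvdp_gcdr.
have co : coprimep (A %/ g) (b %/ g) by apply: coprimep_div_gcd; rewrite b0 orbT.
have E' : (A %/ g) ^+ m * R = H * (b %/ g) ^+ m.
  apply: (mulIf (expf_neq0 m g0)).
  by rewrite mulrAC -exprMn -EA E -mulrA -exprMn -Eb.
have b'0 : b %/ g != 0 by apply: contraNneq b0 => b'0; rewrite Eb b'0 mul0r.
have /size_poly1P[c c0 Ec] : size (b %/ g) == 1%N.
  apply/eqP/closed_size1 => // x bx; have := nR x.
  rewrite -(@Gauss_dvdpr _ _ ((A %/ g) ^+ m)); last first.
    apply: coprimep_expl; apply: coprimep_expr; rewrite coprimep_sym coprimep_XsubC.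
    apply/negP => ax; have := coprimep_root co ax.
    by rewrite (rootP bx) eqxx.
  rewrite E' dvdp_mull //; apply: dvdp_exp2r.
  by rewrite dvdp_XsubCl.
rewrite EA Eb; apply: dvdp_mul => //.
by rewrite Ec dvdpE -dvdpE; apply/dvdp_trans/dvd1p; rewrite dvdp1 size_polyC c0.
Qed.

Lemma prod_XsubC_exp_ndvd (r m : nat) (alpha : 'I_r -> K) (e : 'I_r -> nat) (x : K) :
    (0 < m)%N -> injective alpha -> (forall i, (e i < m)%N) ->
  ~~ (('X - x%:P) ^+ m %| \prod_i ('X - (alpha i)%:P) ^+ e i).
Proof.
move=> m_gt0 alpha_inj lt_e; apply/negP => dvd.
have rt : root (\prod_i ('X - (alpha i)%:P) ^+ e i) x.
  apply: (root_dvdp dvd); case: (m) m_gt0 => // k _.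
  by rewrite rootE horner_exp hornerXsubC subrr expr0n.
have [i Ei] : exists i, x = alpha i.
  move: rt; rewrite rootE horner_prod prodf_seq_eq0 => /hasP[i _ /=].
  by rewrite horner_exp hornerXsubC expf_eq0 subr_eq0 => /andP[_ /eqP]; exists i.
move: dvd; rewrite (bigD1 i) //= -Ei Gauss_dvdpl.
  move/dvdp_leq; rewrite expf_neq0 ?polyXsubC_eq0 // !size_exp_XsubC => /(_ isT).
  by rewrite ltnS leqNgt lt_e.
apply: coprimep_expl; rewrite coprimep_sym; elim/big_rec: _ => [|j q ji co_q].
  exact: coprime1p.
rewrite coprimepMl co_q andbT; apply: coprimep_expl.
rewrite coprimep_XsubC root_XsubC; apply: contra ji => /eqP xj.
by apply/eqP/alpha_inj; rewrite -xj.
Qed.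

Variables (L : fieldType) (phi : {rmorphism {poly K} -> L}).
Hypothesis phi_inj : injective phi.

Let phi_eq0 a : (phi a == 0) = (a == 0).
Proof. exact: raddf_eq0. Qed.

(** Rational root argument: for coprime [a] and [b], clearing denominators in the monic equation
    makes every root of [b] a root of [a], so [b] is constant. *)
Lemma integral_fraction (a b : {poly K}) : b != 0 ->
  integralOver phi (phi a / phi b) -> exists h, phi a / phi b = phi h.
Proof.
wlog co : a b / coprimep a b.
  move=> IH b0; pose g := gcdp a b.
  have g0 : g != 0 by rewrite gcdp_eq0 negb_and b0 orbT.
  have Ea : a = a %/ g * g by rewrite divpK // dvdp_gcdl.
  have Eb : b = b %/ g * g by rewrite divpK // dvdp_gcdr.
  have b'0 : b %/ g != 0 by apply: contraNneq b0 => b'0; rewrite Eb b'0 mul0r.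
  have -> : phi a / phi b = phi (a %/ g) / phi (b %/ g).
    by rewrite {1}Ea {1}Eb !rmorphM /= -mulf_div divff ?mulr1 // phi_eq0.
  by apply: IH => //; apply: coprimep_div_gcd; rewrite b0 orbT.
move=> b0 [p p_monic /rootP]; pose n := (size p).-1.
have sp : size p = n.+1 by rewrite prednK // size_poly_gt0 monic_neq0.
have B0 : phi b != 0 by rewrite phi_eq0.
have pn : p`_n = 1 by apply: (monicP p_monic).
rewrite (@horner_coef_wide _ n.+1) ?(leq_trans (size_poly _ _)) ?sp //.
move/(congr1 ( *%R (phi b ^+ n))); rewrite mulr0 mulr_sumr => E.
have {}E : \sum_(i < n.+1) p`_i * a ^+ i * b ^+ (n - i) = 0.
  apply: phi_inj; rewrite rmorph0 -[RHS]E rmorph_sum; apply: eq_bigr => i _.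
  have -> : phi b ^+ n = phi b ^+ (n - i) * phi b ^+ i by rewrite -exprD subnK ?leq_ord.
  rewrite coef_map !rmorphM !rmorphXn expr_div_n /=.
  by have := expf_neq0 i B0; move: (phi b ^+ i) => w w0; field.
have /eqP/size_poly1P[c c0 ->] : size b = 1%N.
  apply: closed_size1 => // x bx; move/(congr1 (horner^~ x)): E.
  rewrite horner_sum big_ord_recr /= subnn expr0 mulr1 pn mul1r.
  rewrite big1 ?add0r => [|i _].
    rewrite horner_exp horner0 => /eqP; rewrite expf_eq0 => /andP[_ ax].
    by have := coprimep_root co ax; rewrite (rootP bx) eqxx.
  rewrite hornerM horner_exp (rootP bx) expr0n subn_eq0 leqNgt ltn_ord /=.
  by rewrite mulr0.
exists (a * c^-1%:P); rewrite rmorphM /=; congr (_ * _).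
have C0 : phi c%:P != 0 by rewrite phi_eq0 polyC_eq0.
by apply: (mulfI C0); rewrite mulfV // -rmorphM -polyCM divff // rmorph1.
Qed.

End PolyClosed.

(** * Integrality of the components of an integral element *)

Section Components.

Variables (K : closedFieldType) (L : fieldType) (phi : {rmorphism {poly K} -> L}).
Variables (m : nat) (y : L).
Hypotheses (m_gt0 : (0 < m)%N) (m_neq0 : m%:R != 0 :> K).
Hypothesis kummer_aut : forall w : K, w ^+ m = 1 -> exists s : {rmorphism L -> L},
  (forall a, s (phi a) = phi a) /\ s y = phi w%:P * y.

(* Averaging over the Kummer automorphisms y |-> w y isolates one component. *)
Lemma integral_component (a b : 'I_m -> {poly K}) :
    integralOver phi (\sum_j kterm phi y (a j) (b j) j) ->
  forall j, integralOver phi (kterm phi y (a j) (b j) j).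
Proof.
set t := fun j => kterm phi y (a j) (b j) j; set z := \sum_j _ => int_z j.
have [w prim_w] := closed_primitive_root m_gt0 m_neq0.
have wm i : (w ^+ i) ^+ m = 1 by rewrite exprAC (prim_expr_order prim_w) expr1n.
have [s sP] := choice (fun i => kummer_aut (wm i)).
have int_s i : integralOver phi (s i z).
  have := integral_rmorph (s i) int_z.
  by congr (integralOver _ _); apply/funext => c /=; rewrite (sP i).1.
have s_t i k : s i (t k) = phi ((w ^+ (i * k))%:P) * t k.
  rewrite /t /kterm !rmorphM fmorphV rmorphXn /= !(sP i).1 (sP i).2.
  by rewrite exprMn -rmorphXn -polyC_exp -exprM mulrCA.
(* Orthogonality of the powers of [w]; [m - j] stands for $-j$ modulo [m], avoiding negative
   exponents. *)
have geo (k : 'I_m) : \sum_(i < m) (w ^+ (m - j + k)) ^+ i = m%:R *+ (k == j).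
  have [->|kj] := eqVneq k j.
    rewrite subnK ?(ltnW (ltn_ord j)) // (prim_expr_order prim_w).
    by rewrite (eq_bigr (fun=> 1)) ?sumr_const ?card_ord // => i _; rewrite expr1n.
  have w1 : w ^+ (m - j + k) - 1 != 0.
    rewrite subr_eq0 -[1](expr0 w) (eq_prim_root_expr prim_w).
    apply: contra kj => /eqP/(congr1 (fun u => (u + j) %% m)%N).
    rewrite !modnDml add0n addnAC subnK ?(ltnW (ltn_ord j)) // modnDl.
    by rewrite !modn_small // => kj; apply/eqP/val_inj.
  apply: (mulfI w1); rewrite -subrX1 exprAC (prim_expr_order prim_w) expr1n subrr.
  by rewrite mulr0.
(* Projection onto the [j]-th component: $m\,t_j = \sum_i w^{-ij} s_i(z)$. *)
have E : phi m%:R%:P * t j = \sum_(i < m) phi ((w ^+ (i * (m - j)))%:P) * s i z.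
  under eq_bigr => i _.
    rewrite rmorph_sum mulr_sumr; under eq_bigr => k _.
      rewrite s_t mulrA -rmorphM -polyCM -exprD -mulnDr mulnC exprM /=; over.
    over.
  rewrite exchange_big /= (bigD1 j) //= [X in _ + X]big1 ?addr0 => [|k kj].
    by rewrite -mulr_suml -rmorph_sum -(rmorph_sum polyC) geo eqxx.
  rewrite -mulr_suml -rmorph_sum -(rmorph_sum polyC) geo (negbTE kj).
  by rewrite mulr0n !rmorph0 mul0r.
rewrite -/(t j); have -> : t j = phi (m%:R^-1)%:P * (phi m%:R%:P * t j).
  by rewrite mulrA -rmorphM -polyCM mulVf // polyC1 rmorph1 mul1r.
apply: integral_mul; first exact: integral_id.
rewrite E; elim/big_ind: _ => [|u v|i _]; [exact: integral0|exact: integral_add|].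
by apply: integral_mul => //; apply: integral_id.
Qed.

End Components.

(** * Functions regular away from infinity and their pole orders *)

Section KummerProduct.

Variables (K : closedFieldType) (L : fieldType) (phi : {rmorphism {poly K} -> L}).
Hypothesis phi_inj : injective phi.
Variables (m r : nat) (y : L) (alpha : 'I_r -> K) (lambda : 'I_r -> nat).
Hypotheses (m_gt0 : (0 < m)%N) (m_neq0 : m%:R != 0 :> K) (alpha_inj : injective alpha).

Definition kpoly (e : 'I_r -> nat) : {poly K} := \prod_i ('X - (alpha i)%:P) ^+ e i.

Lemma kpoly_neq0 e : kpoly e != 0.
Proof. by apply/prodf_neq0 => i _; rewrite expf_neq0 // polyXsubC_eq0. Qed.

Lemma size_kpoly e : size (kpoly e) = (\sum_i e i).+1.
Proof.
rewrite size_prod => [|i _]; last by rewrite expf_neq0 // polyXsubC_eq0.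
rewrite (eq_bigr (fun i => (e i + 1)%N)) => [|i _];
  last by rewrite size_exp_XsubC addn1.
by rewrite big_split /= sum1_card -addSn addnK.
Qed.

(** The largest monic polynomial whose [m]-th power divides the [j]-th power of [kpoly lambda]; the
    cofactor [krem j] has all exponents below [m]. *)
Definition kden (j : nat) := kpoly (fun i => j * lambda i %/ m)%N.
Definition krem (j : nat) := kpoly (fun i => j * lambda i %% m)%N.

Lemma kpoly_exp j : kpoly lambda ^+ j = kden j ^+ m * krem j.
Proof.
rewrite /kden /krem /kpoly -!prodrXl -big_split; apply: eq_bigr => i _ /=.
by rewrite -!exprM -exprD -divn_eq mulnC.
Qed.

Hypothesis y_eq : y ^+ m = phi (kpoly lambda).

Let phi_eq0 a : (phi a == 0) = (a == 0).
Proof. exact: raddf_eq0. Qed.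

Lemma kterm_exp a b j :
  kterm phi y a b j ^+ m = phi (a ^+ m * kpoly lambda ^+ j) / phi (b ^+ m).
Proof.
rewrite /kterm !exprMn exprVn exprAC y_eq -!rmorphXn -mulrA mulrCA rmorphM /=.
by rewrite mulrCA mulrA mulrAC -mulrA mulrCA mulrA.
Qed.

Hypothesis kummer_aut : forall w : K, w ^+ m = 1 -> exists s : {rmorphism L -> L},
  (forall a, s (phi a) = phi a) /\ s y = phi w%:P * y.
Hypothesis kexpand : forall z : L, exists a b : 'I_m -> {poly K},
  (forall j, b j != 0) /\ z = \sum_j kterm phi y (a j) (b j) j.

Lemma integral_kexpand z : integralOver phi z ->
  exists h : 'I_m -> {poly K}, z = \sum_j kterm phi y (h j) (kden j) j.
Proof.
have [a [b [b0 ->]]] :=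
  kexpand z => /(integral_component m_gt0 m_neq0 kummer_aut) int_t.
suff /choice[h hP] : forall j : 'I_m, exists h,
    kterm phi y (a j) (b j) j = kterm phi y h (kden j) j.
  by exists h; apply: eq_bigr => j _.
move=> j; have := integral_exp m (int_t j); rewrite kterm_exp.
have bm0 : b j ^+ m != 0 by rewrite expf_neq0.
move=> /(integral_fraction phi_inj bm0)[H].
have Bm0 : phi (b j ^+ m) != 0 by rewrite phi_eq0.
move/(canRL (mulfVK Bm0)); rewrite -rmorphM => /phi_inj;
  rewrite kpoly_exp mulrA -exprMn => E.
(* By [E], $(a_j \cdot \mathrm{kden}_j)^m\,\mathrm{krem}_j = H\,b_j^m$, and no [m]-th power of a
   linear factor divides [krem j]. *)
have /dvdpP[h Eh] : b j %| a j * kden j.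
  apply: dvdp_of_exp E => // x; apply: prod_XsubC_exp_ndvd => // i.
  by rewrite ltn_mod.
exists h; rewrite /kterm; congr (_ * _).
by apply/eqP; rewrite eqr_div ?phi_eq0 ?kpoly_neq0 // -!rmorphM Eh.
Qed.

Hypothesis coprime_deg : coprime m (lambda0 lambda).

Let f0 := kpoly_neq0 lambda.
Let coprime_f : coprime m (size (kpoly lambda)).-1.
Proof. by rewrite size_kpoly. Qed.

Lemma integral_pole_order v z (s : nat) : infinite_valuation phi v ->
    (exists t, t != 0 /\ v t = 1) ->
    integralOver phi z -> z != 0 -> v z = - s%:Z ->
  exists (j : 'I_m) (d : nat),
    (s + m * \sum_i (j * lambda i %/ m) = m * d + j * lambda0 lambda)%N.
Proof.
move=> inf_v v1 /integral_kexpand[h Ez] z0 vz.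
have h0 : exists j, h j != 0.
  apply: contrapT => /forallNP h0; case/eqP: z0; rewrite Ez big1 // => j _.
  by move: (h0 j) => /negP; rewrite negbK => /eqP ->; rewrite /kterm rmorph0 !mul0r.
have [j hj /(_ v inf_v)[_]] := infinite_valuation_sum phi_inj m_gt0 f0 y_eq coprime_f
   (b := fun j : 'I_m => kden j) (fun j => kpoly_neq0 _) h0.
rewrite -Ez vz (infinite_valuation_x phi_inj m_gt0 f0 y_eq coprime_f kexpand inf_v v1).
rewrite /kdeg !size_kpoly -/(lambda0 lambda) /= => E.
(* The witness [d] is the degree of the numerator of the dominant component. *)
exists j, (size (h j)).-1; have sh : (0 < size (h j))%N by rewrite size_poly_gt0.
have mP : (0 : int) < m by [].
have {}E : s%:Z = m%:Z * ((size (h j))%:Z - (\sum_i (j * lambda i %/ m)).+1%:Z) +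
  j%:Z * (lambda0 lambda)%:Z.
  by apply: (mulfI (lt0r_neq0 mP)); apply: oppr_inj; rewrite -mulrN E mulNr.
move: E; set S := (\sum_i _)%N; set l := lambda0 lambda; have -> :
  (size (h j) = (size (h j)).-1.+1)%N by rewrite prednK.
move: (size (h j)).-1 => d E; apply/eqP; rewrite -eqz_nat; apply/eqP.
by rewrite !PoszD !PoszM E; lia.
Qed.

Lemma kummer_pole v (j : 'I_m) d (s : nat) : infinite_valuation phi v ->
    (exists t, t != 0 /\ v t = 1) ->
    (s + m * \sum_i (j * lambda i %/ m) = m * d + j * lambda0 lambda)%N ->
  v (kterm phi y 'X^d (kden j) j) = - s%:Z.
Proof.
move=> inf_v v1 Es.
have mP : (0 : int) < m by [].
apply: (mulfI (lt0r_neq0 mP)).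
have X0 : 'X^d != 0 :> {poly K} by rewrite monic_neq0 ?monicXn.
rewrite (infinite_valuation_kterm phi_inj m_gt0 f0 y_eq j inf_v X0 (kpoly_neq0 _)).
rewrite (infinite_valuation_x phi_inj m_gt0 f0 y_eq coprime_f kexpand inf_v v1).
rewrite /kdeg !size_kpoly size_polyXn -/(lambda0 lambda) /=.
move: Es; set S := (\sum_i _)%N; set l := lambda0 lambda => /(congr1 Posz).
by rewrite !PoszD !PoszM => Es; rewrite mulNr mulrN; congr (- (_ * _)); clear -Es; lia.
Qed.

(** The [m]-th power of this term is the polynomial $x^{dm}\,\mathrm{krem}_j$. *)
Lemma kterm_regular v (j : 'I_m) d : is_valuation v ->
    (forall c, v (phi c%:P) = 0) -> 0 <= v (phi 'X) ->
  0 <= v (kterm phi y 'X^d (kden j) j).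
Proof.
move=> val_v vC vX.
have X0 : 'X^d != 0 :> {poly K} by rewrite monic_neq0 ?monicXn.
have t0 : kterm phi y 'X^d (kden j) j != 0.
  by rewrite (kterm_eq0 phi_inj m_gt0 f0 y_eq) ?kpoly_neq0.
have mP : (0 : int) < m by [].
rewrite -(pmulr_rge0 _ mP) -(valuationX val_v) // kterm_exp kpoly_exp mulrCA rmorphM /=.
rewrite mulrAC divff ?mul1r; last by rewrite phi_eq0 expf_neq0 // kpoly_neq0.
exact: valuation_poly_ge0.
Qed.

End KummerProduct.

(** * Places of the function field *)

Section OfPoly.

Variables (K : fieldType) (L : fieldExtType (ratfun K)).

HB.instance Definition _ :=
  GRing.RMorphism.copy (@of_poly K L) (in_alg L \o @tofrac {poly K}).

Lemma of_poly_eq0 (a : {poly K}) : (of_poly L a == 0) = (a == 0).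
Proof. by rewrite /of_poly scaler_eq0 oner_eq0 orbF tofrac_eq0. Qed.

Lemma fraction_numden (R : idomainType) (c : {fraction R}) :
  exists a b : R, b != 0 /\ c * tofrac b = tofrac a.
Proof.
elim/quotW: c => x; exists (frac x).1, (frac x).2; split; first exact: denom_ratioP.
unlock FracField.tofrac; rewrite -[LHS]FracField.pi_mul.
apply/eqmodP; rewrite /= FracField.equivfE /FracField.mulf.
have x20 := denom_ratioP x.
by rewrite !numden_Ratio ?mulr1 ?oner_neq0 // mulrC.
Qed.

Lemma ratfun_div (c : ratfun K) :
  exists a b : {poly K}, b != 0 /\ c%:A = of_poly L a / of_poly L b.
Proof.
have [a [b [b0 E]]] := fraction_numden c; exists a, b; split=> //.
have B0 : of_poly L b != 0 by rewrite of_poly_eq0.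
apply/(canRL (mulfK B0)).
by rewrite /of_poly -scalerAl mul1r scalerA E.
Qed.

End OfPoly.

Section Places.

Variables (K : closedFieldType) (L : fieldExtType (ratfun K)).
Local Notation ofp := (@of_poly K L : {rmorphism {poly K} -> L}).

Lemma of_poly_inj : injective ofp.
Proof. by apply: raddf_inj => a /eqP; rewrite of_poly_eq0 => /eqP. Qed.

Lemma polyOver1_fractions (p : {poly L}) : p \is a polyOver 1%VS ->
  exists a b : nat -> {poly K}, forall j, b j != 0 /\ p`_j = ofp (a j) / ofp (b j).
Proof.
move=> /polyOverP p1.
suff /choice[ab abP] : forall j, exists ab : {poly K} * {poly K},
    ab.2 != 0 /\ p`_j = ofp ab.1 / ofp ab.2.
  by exists (fun j => (ab j).1), (fun j => (ab j).2).
move=> j; have /vlineP[c ->] := p1 j.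
by have [a [b abE]] := ratfun_div L c; exists (a, b).
Qed.

Lemma of_poly_algebraic (z : L) : exists2 p : {poly L},
  [/\ p != 0, (size p <= (\dim {:L}).+1)%N & root p z] &
  forall i, exists a b : {poly K}, b != 0 /\ p`_i = ofp a / ofp b.
Proof.
exists (minPoly 1 z); last first.
  by move=> i; have [a [b abP]] := polyOver1_fractions (minPolyOver 1%AS z);
    exists (a i), (b i).
split; [exact/monic_neq0/monic_minPoly | | exact: root_minPoly].
rewrite size_minPoly ltnS.
have <- : \dim <<1; z>> = adjoin_degree 1 z by rewrite dim_Fadjoin dimv1 muln1.
by apply: dimvS; apply: subvf.
Qed.

Lemma place_valuation (P : place L) : is_valuation P.
Proof. by split; [apply: place_ord0 | apply: place_ordM | apply: place_ordD]. Qed.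

Lemma place_inj (P Q : place L) : (forall z, z != 0 -> P z = Q z) -> P = Q.
Proof.
case: P Q => v v0 vM vD vC vS [v' v0' vM' vD' vC' vS'] /= E.
have {E} E : v = v'.
  by apply/funext => f; have [->|/E] := eqVneq f 0; rewrite ?v0 ?v0'.
by subst v'; congr Place; apply: Prop_irrelevance.
Qed.

Lemma integral_of_places (z : L) :
  (forall P : place L, 0 <= P (ofp 'X) -> 0 <= P z) -> integralOver ofp z.
Proof.
move=> Pz; apply: contrapT => nint.
have [v [[v0 vM vD] v1 vC vX]] :=
  nonintegral_valuation of_poly_inj of_poly_algebraic nint.
by rewrite ltNge (Pz (Place v0 vM vD vC v1)).
Qed.

Variables (m : nat) (f : {poly K}) (y : L).
Hypotheses (m_gt0 : (0 < m)%N) (L_gen : (<<1; y>> = fullv)%VS) (y_eq : y ^+ m = ofp f).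

(** An element is a polynomial in [y]; reducing it modulo $X^m - f$, which vanishes at [y], leaves
    [m] coefficients. *)
Lemma kummer_expansion (z : L) : exists a b : 'I_m -> {poly K},
  (forall j, b j != 0) /\ z = \sum_j kterm ofp y (a j) (b j) j.
Proof.
have /Fadjoin_polyP[p p1 ->] : z \in <<1; y>>%VS by rewrite L_gen memvf.
pose g := 'X^m - (ofp f)%:P.
have g1 : g \is a polyOver 1%VS.
  by rewrite rpredB ?rpredX ?polyOverX // polyOverC rpredZ // mem1v.
have gy : root g y by rewrite rootE !hornerE y_eq subrr.
have sg : size g = m.+1 by rewrite size_XnsubC.
have g0 : g != 0 by rewrite -size_poly_eq0 sg.
have [a [b abP]] := polyOver1_fractions (modp_polyOver p1 g1).
exists (fun j => a j), (fun j => b j); split=> [j|]; first by case: (abP j).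
have -> : p.[y] = (p %% g).[y].
  by rewrite {1}(divp_eq p g) hornerD hornerM (rootP gy) mulr0 add0r.
have le_q : (size (p %% g)%R <= m)%N by rewrite -ltnS -sg ltn_modp.
rewrite (horner_coef_wide _ le_q).
by apply: eq_bigr => j _; case: (abP j) => _ ->.
Qed.

Hypotheses (f0 : f != 0) (coprime_deg : coprime m (size f).-1).
Variables (v : L -> int) (inf_v : infinite_valuation ofp v).

(* The distinct values at infinity of the y^j force the minimal polynomial of y
   to be the Kummer polynomial. *)
Lemma kummer_root_minPoly (w : L) : w ^+ m = ofp f -> root (minPoly 1 y) w.
Proof.
move=> w_eq; pose g := 'X^m - (ofp f)%:P.
have g1 : g \is a polyOver 1%VS.
  by rewrite rpredB ?rpredX ?polyOverX // polyOverC rpredZ // mem1v.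
have gy : root g y by rewrite rootE !hornerE y_eq subrr.
have gw : root g w by rewrite rootE !hornerE w_eq subrr.
have sg : size g = m.+1 by rewrite size_XnsubC.
have g0 : g != 0 by rewrite -size_poly_eq0 sg.
have dvd : minPoly 1 y %| g by apply: minPoly_dvdp.
suff /eqp_root <- : g %= minPoly 1 y by [].
(* A minimal polynomial of size at most [m] would be a vanishing combination of the $y^j$, $j < m$,
   with leading coefficient 1. *)
rewrite eqp_sym -dvdp_size_eqp // eqn_leq dvdp_leq // sg ltnNge; apply/negP => le_m.
have [a [b abP]] := polyOver1_fractions (minPolyOver 1%AS y).
have E : \sum_(j < m) kterm ofp y (a j) (b j) j = 0.
  rewrite -[RHS](minPolyxx 1 y) (horner_coef_wide _ le_m).
  by apply: eq_bigr => j _; case: (abP j) => _ ->.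
have b0 (j : 'I_m) : b j != 0 by case: (abP j).
have a0 : exists j : 'I_m, a j != 0.
  have lt_n : ((size (minPoly 1 y)).-1 < m)%N.
    by move: le_m; rewrite size_minPoly.
  exists (Ordinal lt_n); apply/eqP => a0; have [_] := abP (Ordinal lt_n).
  rewrite a0 rmorph0 mul0r /= -lead_coefE (monicP (monic_minPoly _ _)) => /eqP.
  by rewrite oner_eq0.
have [j _ /(_ v inf_v)[]] :=
  infinite_valuation_sum of_poly_inj m_gt0 f0 y_eq coprime_deg b0 a0.
by rewrite E eqxx.
Qed.

(** Since $wy$ is again a root of the minimal polynomial of [y], the identity of the base field
    extends to $y \mapsto wy$. *)
Lemma kummer_automorphism (w : K) : w ^+ m = 1 -> exists s : {rmorphism L -> L},
  (forall a, s (ofp a) = ofp a) /\ s y = ofp w%:P * y.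
Proof.
move=> wm.
have wy_root : root (minPoly 1 y) (ofp w%:P * y).
  apply: kummer_root_minPoly; rewrite exprMn y_eq -rmorphXn -polyC_exp wm.
  by rewrite polyC1 rmorph1 mul1r.
have min_id : map_poly \1%VF (minPoly 1 y) = minPoly 1 y.
  by apply: kHom_poly_id (kHom1 1 1) _; apply: minPolyOver.
rewrite -min_id in wy_root.
have hom := kHomExtendP (subvv 1%VS) (kHom1 1 1) wy_root.
have val_y := kHomExtend_val (kHom1 1 1) wy_root.
set s := kHomExtend _ _ _ _ in hom val_y.
rewrite L_gen in hom.
have homM : monoid_morphism s by apply/kHom_monoid_morphism.
pose s_mul := GRing.isMonoidMorphism.Build _ _ _ homM.
pose sR : {rmorphism L -> L} := HB.pack (fun_of_lfun s) s_mul.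
exists sR; split=> // a /=.
by have [idK _] := kHomP_tmp hom; apply: idK; rewrite rpredZ // mem1v.
Qed.

End Places.

(** * The numbers eta *)

Section Combinatorics.

Lemma leq_bigmin (I : eqType) (s : seq I) (F : I -> nat) (m b : nat) :
  (b <= \big[minn/m]_(i <- s) F i)%N = (b <= m)%N && all (fun i => b <= F i)%N s.
Proof.
elim: s => [|i s IHs]; first by rewrite big_nil andbT.
by rewrite big_cons leq_min IHs /= andbCA.
Qed.

(** Starting from [c], one coordinate still below its bound is raised by 1 at each step. *)
Lemma sum_interpolation (r : nat) (c l : 'I_r -> nat) (a : nat) :
    (forall i, c i <= l i)%N -> (\sum_i c i <= a <= \sum_i l i)%N ->
  exists2 s : 'I_r -> nat, (forall i, c i <= s i <= l i)%N & (\sum_i s i = a)%N.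
Proof.
move=> le_cl /andP[]; elim: a => [|a IHa] le_c le_l.
  exists c; first by move=> i; rewrite leqnn le_cl.
  by apply/eqP; rewrite -leqn0.
move: le_c; rewrite leq_eqVlt => /orP[/eqP E|lt_c].
  by exists c => // i; rewrite leqnn le_cl.
have [s s_cl s_sum] := IHa lt_c (ltnW le_l).
have [i lt_i] : exists i, (s i < l i)%N.
  apply/existsP; apply: contraLR le_l; rewrite negb_exists => /forallP le_ls.
  by rewrite -ltnNge ltnS -s_sum leq_sum // => i _; rewrite leqNgt le_ls.
exists (fun k => s k + (k == i))%N => [k|].
  have /andP[cs sl] := s_cl k; case: eqP => [->|_]; last by rewrite addn0 cs.
  by rewrite addn1 lt_i leqW //; case/andP: (s_cl i).
rewrite big_split s_sum /= (bigD1 i) //= eqxx big1 ?addn1 // => k /negbTE ->.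
by [].
Qed.

Lemma bigmax_int_attained (s : seq nat) (F : nat -> int) (x : int) :
  let M := \big[Order.max/x]_(k <- s) F k in
  [/\ x <= M, {in s, forall k, F k <= M} & M = x \/ exists2 k, k \in s & M = F k].
Proof.
elim: s => [|i s [IHx IHs IHM]] /=; first by rewrite big_nil; split=> //; left.
rewrite big_cons; set M := \big[_/_]_(_ <- s) _ in IHx IHs IHM *.
have le_M : M <= Order.max (F i) M by rewrite le_max lexx orbT.
split; first exact: le_trans le_M.
  move=> k; rewrite inE => /predU1P[->|ks]; first by rewrite le_max lexx.
  exact: le_trans (IHs _ ks) le_M.
have [_|_] := leP (F i) M; last by right; exists i; rewrite ?mem_head.
by case: IHM => [->|[k ks ->]]; [left|right; exists k; rewrite // inE ks orbT].
Qed.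

Variables (m r : nat) (lambda : 'I_r -> nat).
Hypothesis lambda_bounds : forall i, (1 <= lambda i < m)%N.
Local Notation l0 := (lambda0 lambda).
Local Notation S j := (\sum_i (j * lambda i %/ m))%N.

(* The i-th part of a decomposition realizing the bound m - j is at least
   ceil ((m - j) lambda_i / m) = lambda_i - floor (j lambda_i / m). *)
Lemma leq_eta (a j : nat) : (j < m)%N -> (a < l0)%N ->
  (m - j <= eta_seq m lambda a)%N = (l0 <= a + S j)%N.
Proof.
move=> lt_jm lt_a; have m_gt0 : (0 < m)%N by apply: leq_ltn_trans lt_jm.
have [l_gt0 l_lt] : (forall i, 0 < lambda i)%N /\ (forall i, lambda i < m)%N.
  by split=> i; case/andP: (lambda_bounds i).
pose c i := (lambda i - j * lambda i %/ m)%N.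
have lt_q i : (j * lambda i %/ m < lambda i)%N.
  by rewrite ltn_divLR // mulnC ltn_pmul2l.
have c_gt0 i : (0 < c i)%N by rewrite subn_gt0.
have c_le i : (c i <= lambda i)%N by apply: leq_subr.
have cP i t : (t <= lambda i)%N -> (m - j <= t * m %/ lambda i)%N = (c i <= t)%N.
  move=> le_t; rewrite leq_divRL // /c leq_subCl leq_divRL // !mulnBl leq_subCl.
  by rewrite (mulnC m).
have sum_c : (\sum_i c i + S j = l0)%N.
  by rewrite -big_split; apply: eq_bigr => i _; rewrite /= subnK // ltnW.
rewrite -sum_c leq_add2r /eta_seq; case: ltnP => [lt_ar|le_ra].
  (* For $a < r$ both sides fail: $\eta_a = 0 < m - j$, and the [r] numbers [c i] are at least 1, so
     their sum exceeds [a]. *)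
  rewrite leqn0 subn_eq0 leqNgt lt_jm; apply/esym/negbTE; rewrite -ltnNge.
  apply: leq_trans lt_ar _; rewrite -[r in (r <= _)%N]card_ord -sum1_card.
  exact: leq_sum.
rewrite [(lambda0 _ <= a)%N]leqNgt lt_a /=.
have mj : (m - j = (m - j).-1.+1)%N by rewrite prednK // subn_gt0.
(* A decomposition reaching [m - j] dominates [c] termwise, so [a] is at least the sum of the [c i];
   conversely one is found by interpolating between [c] and [lambda]. *)
apply/idP/idP => [|le_c].
  apply: contraLR; rewrite -!ltnNge => lt_c; rewrite mj ltnS.
  apply/bigmax_leqP => s /andP[/eqP s_sum /forallP s_l].
  rewrite -ltnS -mj ltnNge leq_bigmin; apply: contraL lt_c => /andP[_ /allP s_min].
  rewrite -leqNgt -s_sum; apply: leq_sum => i _.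
  by rewrite -cP ?s_min ?mem_index_enum //; case/andP: (s_l i).
have [|s s_cl s_sum] := @sum_interpolation r c lambda a c_le.
  by rewrite le_c ltnW.
have lt_s i : (s i < a.+1)%N by rewrite ltnS -s_sum (bigD1 i) //= leq_addr.
pose t : {ffun 'I_r -> 'I_a.+1} := [ffun i => Ordinal (lt_s i)].
have dec_t : decomposition lambda t.
  apply/andP; split.
    by rewrite -[X in _ == X]s_sum; apply/eqP/eq_bigr => i _; rewrite ffunE.
  apply/forallP => i; rewrite ffunE /=; have /andP[cs ->] := s_cl i.
  by rewrite (leq_trans (c_gt0 i)).
apply: leq_trans (leq_bigmax_cond _ dec_t).
rewrite leq_bigmin leq_subr; apply/allP => i _; rewrite ffunE /=.
by have /andP[cs sl] := s_cl i; rewrite cP.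
Qed.

Hypotheses (m_ge2 : (2 <= m)%N) (r_ge2 : (2 <= r)%N) (coprime_ml : coprime m l0).

(** The subtracted sum is moved to the left so that the equation lives in the natural numbers. *)
Definition kummer_semigroup (s : nat) : Prop :=
  exists (j : 'I_m) (d : nat), (s + m * S j = m * d + j * l0)%N.

Definition eta_gap (s : nat) : Prop := exists a b : nat,
  [/\ (1 <= a <= l0.-1)%N, ((eta_seq m lambda a).+1 <= b <= a * m %/ l0)%N
    & s%:Z = (m * a)%N%:Z - (b * l0)%N%:Z].

Lemma l0_ge : (r <= l0)%N.
Proof.
rewrite -[r in (r <= _)%N]card_ord -sum1_card; apply: leq_sum => i _.
by case/andP: (lambda_bounds i).
Qed.

Let l0_gt0 : (0 < l0)%N.
Proof. by apply: leq_trans l0_ge; apply: ltnW. Qed.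
Let m_gt0 : (0 < m)%N.
Proof. exact: ltnW. Qed.

Lemma kummer_semigroup_gap s :
  (0 < s)%N /\ ~ kummer_semigroup s <-> eta_gap s.
Proof.
split=> [[s_gt0 nH]|[a [b [/andP[a_gt0 a_le] /andP[eta_b b_le] Es]]]].
  (* A multiple of [l0] congruent to [s] modulo [m]; reducing its cofactor gives the index [j] with
     $j\lambda_0 \equiv s$. *)
  pose x := chinese m l0 s 0.
  have xs : x = s %[mod m] by apply: chinese_modl.
  have /dvdnP[k xk] : (l0 %| x)%N.
    by rewrite /dvdn; have -> := chinese_modr coprime_ml s 0; rewrite mod0n.
  pose j := Ordinal (ltn_pmod k m_gt0).
  have Ej : (j * l0 = s %[mod m])%N by rewrite modnMml -xk.
  have lt_s : (s + m * S j < j * l0)%N.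
    rewrite ltnNge; apply/negP => le_s; apply: nH; exists j.
    have /dvdnP[d Ed] : (m %| s + m * S j - j * l0)%N.
      by rewrite -eqn_mod_dvd // Ej [(m * _)%N]mulnC addnC modnMDl.
    by exists d; rewrite (mulnC m d) -Ed subnK.
  have /dvdnP[D ED] : (m %| j * l0 - s)%N.
    rewrite -eqn_mod_dvd ?Ej //; apply: leq_trans (ltnW lt_s); exact: leq_addr.
  have le_s : (s <= j * l0)%N by apply: leq_trans (ltnW lt_s); apply: leq_addr.
  have {}ED : (j * l0 = s + m * D)%N by rewrite (mulnC m D) -ED subnKC.
  have lt_SD : (S j < D)%N.
    by move: lt_s; rewrite ED ltn_add2l ltn_pmul2l.
  have lt_jm := ltn_ord j.
  have lt_D : (D < l0)%N.
    rewrite -(ltn_pmul2l m_gt0); apply: leq_ltn_trans (_ : j * l0 < _)%N.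
      by rewrite ED leq_addl.
    by rewrite ltn_pmul2r.
  exists (l0 - D)%N, (m - j)%N; split.
  - by apply/andP; split; lia.
  - rewrite ltnNge leq_eta //; last by lia.
    apply/andP; split; first by rewrite -ltnNge; lia.
    rewrite leq_divRL // !mulnBl (mulnC m) leq_sub2l //.
    by rewrite ED (mulnC m) leq_addl.
  - have [mD jl] : (m * D <= m * l0)%N /\ (j * l0 <= m * l0)%N.
      by rewrite leq_mul2l leq_mul2r !(ltnW lt_D, ltnW lt_jm) !orbT.
    by rewrite mulnBr mulnBl; lia.
have lt_a : (a < l0)%N by lia.
have le_bl : (b * l0 <= a * m)%N by rewrite -leq_divRL.
have lt_bm : (b < m)%N.
  rewrite -(ltn_pmul2r l0_gt0); apply: leq_ltn_trans le_bl _.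
  by rewrite mulnC ltn_pmul2l.
have {}Es : (s + b * l0 = m * a)%N.
  by apply/eqP; rewrite -eqz_nat PoszD Es subrK.
have b_gt0 : (0 < b)%N by apply: leq_ltn_trans eta_b.
(* The bound on [b] gives only $s \geq 0$; equality would force $\lambda_0 \mid a$ by coprimality,
   against $0 < a < \lambda_0$. *)
have s_gt0 : (0 < s)%N.
  rewrite lt0n; apply/eqP => s0; move: Es; rewrite s0 add0n => Eb.
  have : (l0 %| a)%N.
    by rewrite -(@Gauss_dvdr _ m) ?(coprime_sym _ m) // -Eb dvdn_mull.
  by move/dvdn_leq => /(_ a_gt0); rewrite leqNgt lt_a.
split=> // -[j [d EH]].
(* Comparing [EH] and [Es] modulo [m] shows $m \mid j + b$, while $0 < j + b < 2m$. *)
have Ej : (j + b)%N = m.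
  have : (m %| (j + b) * l0)%N.
    rewrite -(@dvdn_addr (m * d) m) ?dvdn_mulr // mulnDl addnA -EH.
    by rewrite addnAC Es -mulnDr dvdn_mulr.
  rewrite Gauss_dvdl // => /dvdnP[[|[|k]]] E; have := ltn_ord j; lia.
move: eta_b; have -> : b = (m - j)%N by apply/esym/eqP;
  rewrite -(eqn_add2l j) subnKC ?Ej // ltnW.
rewrite ltnNge leq_eta //; apply/negP/negPn.
rewrite -(leq_pmul2l m_gt0) mulnDr -Es; apply: (@leq_trans (m * d + j * l0 + b * l0)).
  by rewrite -addnA -mulnDl Ej leq_addl.
by rewrite -EH addnAC.
Qed.

(** For fixed [a] the largest candidate, at $b = \eta_a + 1$, is $\epsilon_a$. For $a < r$ this is
    $ma - \lambda_0$, increasing in [a], so the maximum may start at $r - 1$. *)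
Lemma eta_gap_max : exists2 F : nat,
    eta_gap F /\ (forall s, eta_gap s -> (s <= F)%N) &
  F%:Z = \big[Order.max/eps_seq m lambda r.-1]_(r.-1 <= k < l0) eps_seq m lambda k.
Proof.
set M := \big[_/_]_(_ <= k < _) _.
have [M_ge1 M_ge Mk] :=
  bigmax_int_attained (index_iota r.-1 l0) (eps_seq m lambda) (eps_seq m lambda r.-1).
rewrite -/M in M_ge1 M_ge Mk.
have ltr : (r.-1 < l0)%N by apply: leq_trans l0_ge; rewrite prednK // ltnW.
have eta0 k : (k < r)%N -> eta_seq m lambda k = 0%N by rewrite /eta_seq => ->.
have lt_r : (r.-1 < r)%N by rewrite prednK // ltnW.
(* Either $\epsilon_{r-1} = m(r-1) - \lambda_0 \geq 0$, or $m < \lambda_0$; then [leq_eta] at $j =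
   1$ bounds $\eta_{\lambda_0-1}$ by $m - 2$, whence $\epsilon_{\lambda_0-1} \geq \lambda_0 - m >
   0$. *)
have M_ge0 : 0 <= M.
  have e1 : eps_seq m lambda r.-1 = (m * r.-1)%N%:Z - l0%:Z.
    by rewrite /eps_seq eta0 // muln1.
  have [le_l|lt_l] := leqP l0 (m * r.-1).
    by apply: le_trans M_ge1; rewrite e1; lia.
  have ml : (m < l0)%N.
    apply: leq_ltn_trans lt_l; rewrite -[m in (m <= _)%N]muln1 leq_mul2l.
    by apply/orP; right; lia.
  have : eps_seq m lambda l0.-1 <= M.
    by apply: M_ge; rewrite mem_index_iota; lia.
  apply: le_trans; rewrite /eps_seq.
  have lt_l' : (l0.-1 < l0)%N by rewrite ltn_predL.
  have := @leq_eta l0.-1 1 m_ge2 lt_l'; rewrite (_ : \sum_i _ = 0)%N; last first.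
    rewrite big1 // => i _; rewrite mul1n divn_small //.
    by case/andP: (lambda_bounds i).
  set e := eta_seq _ _ _; rewrite addn0 [RHS]leqNgt lt_l' subn1 => /negbT.
  rewrite -ltnNge => lt_e.
  have : (l0 * e.+1 <= l0 * m.-1)%N by rewrite leq_mul2l; lia.
  move: m_gt0 l0_gt0 ml; case: (m) => // m'; case: (l0) => // l' _ _ /=.
  by rewrite mulSn mulnS; lia.
(* With $b = \eta_k + 1$ the condition $b \leq \lfloor km/\lambda_0 \rfloor$ says exactly
   $\epsilon_k \geq 0$. *)
have gapM k : (r.-1 <= k < l0)%N -> M = eps_seq m lambda k -> eta_gap `|M|%N.
  move=> /andP[rk kl] EM; exists k, (eta_seq m lambda k).+1; split; first by lia.
    rewrite leqnn /= leq_divRL // mulnC (mulnC k) -lez_nat -subr_ge0.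
    by rewrite -/(eps_seq m lambda k) -EM.
  by rewrite gez0_abs // EM /eps_seq (mulnC l0).
exists `|M|%N; last by rewrite gez0_abs.
split.
  case: Mk => [EM|[k ks EM]]; last by apply: (gapM k); rewrite // -mem_index_iota.
  by apply: (gapM r.-1); rewrite // leqnn.
move=> s [a [b [/andP[a_gt0 a_le] /andP[eta_b _] Es]]].
rewrite -lez_nat gez0_abs //; apply: (@le_trans _ _ (eps_seq m lambda a)).
  have : (l0 * (eta_seq m lambda a).+1 <= b * l0)%N by rewrite mulnC leq_mul2r eta_b
    orbT.
  by rewrite Es /eps_seq; lia.
have [le_ra|lt_ar] := leqP r.-1 a; first by apply: M_ge; rewrite mem_index_iota; lia.
apply: le_trans M_ge1; rewrite /eps_seq !eta0 //; last by lia.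
have : (m * a <= m * r.-1)%N by rewrite leq_mul2l ltnW ?orbT.
by lia.
Qed.

End Combinatorics.

(** * The Weierstrass semigroup at infinity *)

Section WeierstrassSemigroup.

Variables (K : closedFieldType) (L : fieldExtType (ratfun K)).
Local Notation ofp := (@of_poly K L : {rmorphism {poly K} -> L}).
Variables (m r : nat) (y : L) (alpha : 'I_r -> K) (lambda : 'I_r -> nat).
Hypotheses (m_gt0 : (0 < m)%N) (m_neq0 : m%:R != 0 :> K) (alpha_inj : injective alpha).
Hypotheses (coprime_ml : coprime m (lambda0 lambda)) (L_gen : (<<1; y>> = fullv)%VS).
Hypothesis y_eq : y ^+ m = ofp (kpoly alpha lambda).
Variables (Q : place L) (Q_infty : over_pole_of_x Q).

Let ofp_inj : injective ofp := @of_poly_inj K L.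
Let f0 := kpoly_neq0 alpha lambda.
Let coprime_f : coprime m (size (kpoly alpha lambda)).-1.
Proof. by rewrite size_kpoly. Qed.
Let expand := kummer_expansion m_gt0 L_gen y_eq.

Let inf_place (P : place L) : over_pole_of_x P -> infinite_valuation ofp P.
Proof. by split=> //; [apply: place_valuation | apply: place_ord_const]. Qed.

Let inf_Q := inf_place Q_infty.
Let aut := kummer_automorphism m_gt0 L_gen y_eq f0 coprime_f inf_Q.

Lemma place_over_pole_unique (P : place L) : P (ofp 'X) < 0 -> P = Q.
Proof.
move=> PX; apply: place_inj => z z0.
exact: (infinite_valuation_unique ofp_inj m_gt0 f0 y_eq coprime_f expand
  (inf_place PX) inf_Q (place_ord_surj P) (place_ord_surj Q) z0).
Qed.

(** Positivity of [s] lets the truncated pole divisor determine the value at [Q]. Places other than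
    [Q] are exactly those where [x] is regular, so having no pole there amounts to integrality over
    $K[x]$. *)
Lemma weierstrass_semigroupE (s : nat) : (0 < s)%N ->
  weierstrass_semigroup Q s <-> kummer_semigroup m lambda s.
Proof.
move=> s_gt0; split=> [[z [z0 Ez]]|[j [d Es]]].
  have Qz : Q z = - s%:Z.
    have := congr1 (fun D => D Q) Ez; rewrite /pole_divisor /point_divisor asboolT //.
    by rewrite /Order.max; case: ifP => _; lia.
  apply: (integral_pole_order ofp_inj m_gt0 m_neq0 alpha_inj y_eq aut expand
    coprime_ml inf_Q (place_ord_surj Q) _ z0 Qz).
  apply: integral_of_places => P PX.
  have PQ : P <> Q by move=> PQ; move: PX; rewrite PQ leNgt Q_infty.
  have := congr1 (fun D => D P) Ez; rewrite /pole_divisor /point_divisor asboolF //.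
  by rewrite /Order.max; case: ifP; lia.
exists (kterm ofp y 'X^d (kden m alpha lambda j) j); split.
  rewrite (kterm_eq0 ofp_inj m_gt0 f0 y_eq) ?kpoly_neq0 //.
  by rewrite monic_neq0 ?monicXn.
apply/funext => P; rewrite /pole_divisor /point_divisor.
case: asboolP => [->|PQ].
  rewrite (kummer_pole ofp_inj m_gt0 y_eq expand coprime_ml inf_Q (place_ord_surj Q)
    Es).
  by rewrite opprK max_r.
apply: max_l; rewrite oppr_le0.
apply: (kterm_regular ofp_inj m_gt0 y_eq j d (place_valuation P) (place_ord_const P)).
rewrite leNgt; apply/negP => PX; apply: PQ.
exact: place_over_pole_unique.
Qed.

End WeierstrassSemigroup.

Theorem proposition4p1
  (p e q : nat) (p_prime : prime p) (e_gt0 : (0 < e)%N) (q_def : q = (p ^ e)%N)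
  (Fq : finFieldType) (card_Fq : #|Fq| = q)
  (K : closedFieldType) (iota : {rmorphism Fq -> K})
  (K_algebraic : integralRange iota)
  (m r : nat) (m_ge2 : (2 <= m)%N) (r_ge2 : (2 <= r)%N)
  (p_ndiv_m : ~~ (p %| m)%N)
  (alpha : 'I_r -> K) (alpha_inj : injective alpha)
  (lambda : 'I_r -> nat)
  (lambda_bounds : forall i, (1 <= lambda i < m)%N)
  (coprime_m_lambda0 : coprime m (lambda0 lambda))
  (L : fieldExtType (ratfun K)) (y : L)
  (L_gen : (<<1; y>> = fullv)%VS)
  (y_eq : y ^+ m = \prod_(i < r) of_poly L ('X - (alpha i)%:P) ^+ lambda i)
  (Qinf : place L) (Qinf_infty : over_pole_of_x Qinf) :
  (exists2 F : nat, is_frobenius_number Qinf F &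
     F%:Z = \big[Order.max/eps_seq m lambda r.-1]_(r.-1 <= k < lambda0 lambda)
              eps_seq m lambda k)
  /\
  gap_set Qinf =
    [set s : nat | exists a b : nat,
       [/\ (1 <= a <= (lambda0 lambda).-1)%N,
           ((eta_seq m lambda a).+1 <= b <= a * m %/ lambda0 lambda)%N
         & s%:Z = (m * a)%N%:Z - (b * lambda0 lambda)%N%:Z]]%classic.
Proof.
have m_gt0 : (0 < m)%N by apply: ltnW.
have m_neq0 : m%:R != 0 :> K.
  (* The embedding [iota] carries the characteristic of [Fq] over to [K]. *)
  have pK : p \in [pchar K].
    by rewrite (fmorph_pchar iota) (@card_finPcharP _ p e) // card_Fq.
  by rewrite -(dvdn_pcharf pK).
have gapE : gap_set Qinf = eta_gap m lambda :> set nat.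
  apply/predeqP => s.
  have yE : y ^+ m = of_poly L (kpoly alpha lambda).
    rewrite y_eq /kpoly rmorph_prod; apply: eq_bigr => i _.
    by rewrite rmorphXn.
  rewrite -(kummer_semigroup_gap lambda_bounds m_ge2 r_ge2 coprime_m_lambda0).
  by split=> -[s_gt0 nH]; split=> // ?; apply: nH;
    apply/(weierstrass_semigroupE m_gt0 m_neq0 alpha_inj coprime_m_lambda0 L_gen yE Qinf_infty s_gt0).
split; last by rewrite gapE.
have [F [gapF maxF] EF] := eta_gap_max lambda_bounds m_ge2 r_ge2 coprime_m_lambda0.
by exists F => //; rewrite /is_frobenius_number gapE.
Qed.
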